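(* Let $1\le\ell<k$ and let $\psi\in\mathbb C^{c_1}\otimes\cdots\otimes\mathbb C^{c_\ell}$ be an $\ell$-tensor. Assume that for every $\theta\in\mathcal P^\ell_{\mathrm{lam}}$ the logarithmic upper and lower quantum functionals agree on $\psi$: $E^\theta(\psi)=E_\theta(\psi)$. Then for any $\theta\in\mathcal P^k_{\mathrm{lam}}$ the logarithmic upper and lower quantum functionals agree on the embedded tensor $\tilde\psi=\psi\otimes e_1^{\otimes(k-\ell)}$: $E^\theta(\tilde\psi)=E_\theta(\tilde\psi)$. In other words, any embedding $\tilde\psi$ of a tensor $\psi\in\mathcal T^\ell_{\mathrm{lq}}$ as a $k$-tensor is in $\mathcal T^k_{\mathrm{lq}}$.
   Context: **Embeddings.** For $\ell<k$ and an $\ell$-tensor $\psi\in\mathbb C^{d_1}\otimes\cdots\otimes\mathbb C^{d_\ell}$, its standard embedding as a $k$-tensor is $\tilde\psi=\psi\otimes e_1^{\otimes(k-\ell)}\in\mathbb C^{d_1}\otimes\cdots\otimes\mathbb C^{d_\ell}\otimes(\mathbb C^1)^{\otimes(k-\ell)}$; more generally, for an ordered subset $(s_1,\dots,s_\ell)$ of distinct elements of $[k]=\{1,\dots,k\}$, the corresponding embedding is obtained by permuting the legs of $\tilde\psi$ so that its first $\ell$ legs are placed at positions $s_1,\dots,s_\ell$. The following definitions are for any order $k$ (and used also with $k$ replaced by $\ell$). **Bipartitions.** $V=V_1\otimes\cdots\otimes V_k$, $V_i=\mathbb C^{d_i}$ with standard inner product, $V_S=\bigotimes_{i\in S}V_i$.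 A bipartition of $[k]$ is an unordered pair $b=\{S,\overline S\}$ with $\emptyset\ne S\subsetneq[k]$, $\overline S=[k]\setminus S$. Two bipartitions $\{S,\overline S\}$, $\{T,\overline T\}$ are mutually laminar if there are $A\in\{S,\overline S\}$, $B\in\{T,\overline T\}$ with $A\subseteq B$; a set of bipartitions is laminar if its members are pairwise mutually laminar. $\mathcal P^k_{\mathrm{lam}}$ is the set of probability distributions on bipartitions of $[k]$ with laminar support. **Lower quantum functional.** For $\psi\neq0$ let $\psi_S:V_{\overline S}^*\to V_S$ be the flattening, $\rho_S=\psi_S\psi_S^*/\|\psi\|_2^2$, $H_b(\psi)=H(\rho_S)$ the von Neumann entropy (base 2), $H_\theta=\sum_b\theta(b)H_b$, $E_\theta(\psi)=\sup_{A_j\in\mathrm{GL}(V_j)}H_\theta((A_1\otimes\cdots\otimes A_k)\psi)$, $E_\theta(0)=-\infty$, $F_\theta=2^{E_\theta}$. **Upper quantum functional.** For $n\ge1$ and $\lambda\vdash n$, let $P_\lambda^{V_S}$ be the projector on $V^{\otimes n}\cong V_S^{\otimes n}\otimes V_{\overline S}^{\otimes n}$ onto the $\lambda$-isotypic component of the symmetric group $S_n$ permuting the factors of $V_S^{\otimes n}$ (acting trivially on $V_{\overline S}^{\otimes n}$), $P_{(n)}^{V_{[k]}}$ the projector onto the symmetric subspace of $V^{\otimes n}$, and $P_\lambda^{V_b}=P_\lambda^{V_S}P_{(n)}^{V_{[k]}}$ for $b=\{S,\overline S\}$ (independent of the side; these commute for mutually laminar bipartitions). For $\theta\in\mathcal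 P^k_{\mathrm{lam}}$, $E^\theta(\psi)=\sup\sum_{b\in\mathrm{supp}\,\theta}\theta(b)H(\lambda^{(b)}/n)$ over all $n\ge1$ and tuples of partitions $\lambda^{(b)}\vdash n$ with $\big(\prod_{b\in\mathrm{supp}\,\theta}P^{V_b}_{\lambda^{(b)}}\big)\psi^{\otimes n}\ne0$, where $H$ is Shannon entropy; $E^\theta(0)=-\infty$; $F^\theta=2^{E^\theta}$. **Laminar-quantum-robust tensors.** $\mathcal T_{\mathrm{lq}}^k$ is the set of nonzero complex $k$-tensors $\psi$ (of any format) with $F^\theta(\psi)=F_\theta(\psi)$ for all $\theta\in\mathcal P^k_{\mathrm{lam}}$. *)

(* Defs.v *)
From HB Require Import structures.
From mathcomp Require Import all_boot all_order all_algebra all_fingroup.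
From mathcomp Require Import mxrepresentation spectral.
From mathcomp Require Import complex.
From mathcomp Require Import boolp classical_sets reals constructive_ereal ereal.
From mathcomp Require Import exp.

Set Implicit Arguments.
Unset Strict Implicit.
Unset Printing Implicit Defensive.

Import Order.TTheory GRing.Theory Num.Theory.
Local Open Scope ring_scope.
Local Open Scope sesquilinear_scope.

(* The basis index x of a k-tensor of format d stands for the standard basis
   vector e_(x_1) (x) ... (x) e_(x_k) of C^(d_1) (x) ... (x) C^(d_k). *)
Notation basis_index d := {dffun forall i, 'I_(d i)}.
Notation tensor R d := {ffun basis_index d -> R[i]}.

Section Entropy.
Variable R : realType.

Definition log2 (x : R) : R := ln x / ln 2.

(* [ln 0 = 0] in the library, so zero probabilities contribute 0. *)
Definition shannon (p : seq R) : R := - \sum_(x <- p) x * log2 x.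

Definition von_neumann m (rho : 'M[R[i]]_m) : R :=
  shannon [seq complex.Re (spectral_diag rho 0 j) | j <- enum 'I_m].

End Entropy.

Section Bipartitions.
Variable k : nat.

Definition is_bipartition (b : {set {set 'I_k}}) : bool :=
  [exists S : {set 'I_k},
    [&& S != finset.set0, S \proper [set: 'I_k] & b == [set S; ~: S]]].

Definition bipartition := {b : {set {set 'I_k}} | is_bipartition b}.

Definition mutually_laminar (b c : bipartition) : bool :=
  [exists A in val b, exists B in val c, A \subset B].

(* One of the two sides of b. The quantities H_b and P_lambda^(V_b) below do
   not depend on which one is picked. *)
Definition side (b : bipartition) : {set 'I_k} :=
  odflt finset.set0 [pick S in val b].

Definition laminar_distribution (R : realType) (theta : bipartition -> R) :=
  [/\ forall b, 0 <= theta b,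
      \sum_b theta b = 1
    & forall b c, theta b != 0 -> theta c != 0 -> mutually_laminar b c].

End Bipartitions.

Section LowerFunctional.
Variables (R : realType) (k : nat) (d : 'I_k -> nat).
Implicit Types (psi : tensor R d) (S : {set 'I_k}).

Definition restrict_index S (x : basis_index d) :
    {dffun forall i : {i : 'I_k | i \in S}, 'I_(d (val i))} :=
  finfun (fun i => x (val i)).

(* The matrix of the flattening V_(~S)^* -> V_S of psi, in the standard basis
   of V_S and the basis dual to the standard one of V_(~S): the flattening
   turns e_x = e_(x|S) (x) e_(x|~S) into the matrix unit E_(x|S, x|~S). *)
Definition flattening S psi :=
  \sum_x psi x *: delta_mx (enum_rank (restrict_index S x))
                           (enum_rank (restrict_index (~: S) x)).

Definition norm2sq psi : R[i] := \sum_x `|psi x| ^+ 2.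

Definition density_mx S psi :=
  (norm2sq psi)^-1 *: (flattening S psi *m (flattening S psi)^t*).

Definition entropy_bip (b : bipartition k) psi : R :=
  von_neumann (density_mx (side b) psi).

Definition entropy_mix (theta : bipartition k -> R) psi : R :=
  \sum_b theta b * entropy_bip b psi.

Definition local_action (A : forall j, 'M[R[i]]_(d j)) psi : tensor R d :=
  [ffun x : basis_index d =>
     \sum_(y : basis_index d) (\prod_j A j (x j) (y j)) * psi y].

Definition log_lower (theta : bipartition k -> R) psi : \bar R :=
  if psi == 0 then -oo%E
  else ereal_sup [set E | exists A : forall j, 'M[R[i]]_(d j),
         (forall j, A j \in unitmx) /\
         E = (entropy_mix theta (local_action A psi))%:E]%classic.

End LowerFunctional.

Section Specht.
Variables (F : fieldType) (n : nat).
Implicit Types lam : seq nat.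

Definition is_partition lam : bool :=
  [&& sorted geq lam, 0%N \notin lam & sumn lam == n].

(* The Young diagram of lam is filled with 0, ..., n-1 row by row, so that m
   lies in row [reshape_index lam m] and column [reshape_offset lam m]. *)
Definition row_group lam : {set 'S_n} :=
  [set s : 'S_n |
    [forall m, reshape_index lam (s m) == reshape_index lam m]].

Definition col_group lam : {set 'S_n} :=
  [set s : 'S_n |
    [forall m, reshape_offset lam (s m) == reshape_offset lam m]].

Definition gring_vec (s : 'S_n) : 'rV[F]_#|[set: 'S_n]%G| :=
  delta_mx 0 (gring_index [set: 'S_n]%G s).

(* Products of permutations are composed from left to right, and
   representations act on row vectors, from the right. *)
Definition young_symmetrizer lam : 'rV[F]_#|[set: 'S_n]%G| :=
  \sum_(p in row_group lam) \sum_(q in col_group lam)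
    (-1) ^+ odd_perm q *: gring_vec (p * q)%g.

Definition specht lam :=
  submod_repr (cyclic_mx_module (regular_repr F [set: 'S_n]%G)
                                (young_symmetrizer lam)).

End Specht.

Section Isotypic.
Variables (R : realType) (n N : nat).
Variable rG : mx_representation R[i] [set: 'S_n]%G N.

(* The elements of [DecSocleType rG] are the isotypic components of rG, and
   [socle_repr W] is the irreducible representation of which W is a multiple;
   the sum has one term, or none if [lam] does not occur in rG. *)
Definition isotypic_component (lam : seq nat) : 'M[R[i]]_N :=
  (\sum_(W : DecSocleType rG |
         `[< mx_rsim (socle_repr W) (specht R[i] n lam) >]) W)%MS.

End Isotypic.

Section UpperFunctional.
Variables (R : realType) (k : nat) (d : 'I_k -> nat).
Implicit Types (psi : tensor R d) (S : {set 'I_k}).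

Section Power.
Variable n : nat.

Notation power_coord := {ffun 'I_n -> basis_index d}.
Notation N := #|{: power_coord}|.

Definition permute_factors S (s : 'S_n) (X : power_coord) : power_coord :=
  [ffun m => finfun (fun i => if i \in S then X ((s^-1)%g m) i else X m i)].

Definition factor_mx S (s : 'S_n) : 'M[R[i]]_N :=
  \matrix_(r < N) delta_mx 0 (enum_rank (permute_factors S s (enum_val r))).

Lemma factor_mx_repr S : mx_repr [set: 'S_n] (factor_mx S).
Proof.
split=> [|s t _ _]; apply/row_matrixP=> r.
  rewrite rowK row1; congr delta_mx; rewrite -[RHS]enum_valK; congr enum_rank.
  by apply/ffunP=> m; apply/ffunP=> i; rewrite !ffunE invg1 perm1 if_same.
rewrite rowK row_mul rowK -rowE rowK enum_rankK; congr delta_mx.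
congr enum_rank; apply/ffunP=> m; apply/ffunP=> i; rewrite !ffunE invMg permM.
by case: (i \in S).
Qed.

Definition factor_repr S : mx_representation R[i] [set: 'S_n]%G N :=
  MxRepresentation (factor_mx_repr S).

(* P_lambda^(V_S) *)
Definition isotypic_proj S (lam : seq nat) : 'M[R[i]]_N :=
  proj_ortho (isotypic_component (factor_repr S) lam).

(* P_(n)^(V_[k]) *)
Definition symmetric_proj : 'M[R[i]]_N :=
  proj_ortho (rfix_mx (factor_repr [set: 'I_k]) [set: 'S_n]).

(* P_lambda^(V_b); vectors are rows, so the left factor is applied first. *)
Definition bip_proj (b : bipartition k) (lam : seq nat) : 'M[R[i]]_N :=
  symmetric_proj *m isotypic_proj (side b) lam.

Definition tensor_power psi : 'rV[R[i]]_N :=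
  \row_(j < N) \prod_m psi (enum_val j m).

End Power.

(* The order of the product is immaterial when theta has laminar support, since
   its factors then commute. *)
Definition log_upper (theta : bipartition k -> R) psi : \bar R :=
  if psi == 0 then -oo%E
  else ereal_sup [set E | exists (n : nat) (lam : bipartition k -> seq nat),
         [/\ (1 <= n)%N,
             forall b, theta b != 0 -> is_partition n (lam b),
             tensor_power n psi *m
               \big[mulmx/1%:M]_(b | theta b != 0) bip_proj n b (lam b) != 0
           & E = (\sum_(b | theta b != 0)
                    theta b * shannon [seq m%:R / n%:R | m <- lam b])%:E]]%classic.

End UpperFunctional.

Section Robust.
Variables (R : realType) (k : nat) (d : 'I_k -> nat).
Implicit Types (theta : bipartition k -> R) (psi : tensor R d).

(* 2 ^ E, with 2 ^ -oo = 0. *)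
Definition exp2e (E : \bar R) : \bar R := expeR ((ln 2)%:E * E)%E.

Definition lower_functional theta psi : \bar R := exp2e (log_lower theta psi).
Definition upper_functional theta psi : \bar R := exp2e (log_upper theta psi).

Definition laminar_quantum_robust psi : Prop :=
  psi != 0 /\
  forall theta, laminar_distribution theta ->
    upper_functional theta psi = lower_functional theta psi.

End Robust.

Section Embedding.
Variables (R : realType) (l k : nat) (c : 'I_l -> nat).

Definition embed_format (s : 'I_l -> 'I_k) (i : 'I_k) : nat :=
  if [pick j | s j == i] is Some j then c j else 1%N.

Lemma embed_formatE (s : 'I_l -> 'I_k) (s_inj : injective s) (j : 'I_l) :
  embed_format s (s j) = c j.
Proof.
rewrite /embed_format; case: pickP => [j' /eqP/s_inj -> //|/(_ j)].
by rewrite eqxx.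
Qed.

(* Leg j of psi is placed at position s j; the vector e_1 of C^1, whose only
   coordinate has index 0, is placed at the remaining positions. *)
Definition embed_tensor (s : 'I_l -> 'I_k) (s_inj : injective s) (psi : tensor R c) :
    tensor R (embed_format s) :=
  [ffun x : basis_index (embed_format s) =>
     psi (finfun (fun j => cast_ord (embed_formatE s_inj j) (x (s j)))) *
     \prod_(i | i \notin codom s) (x i == 0%N :> nat)%:R].

Lemma widen_ord_injective (le_lk : (l <= k)%N) : injective (widen_ord le_lk).
Proof. by move=> i j /(congr1 val) /= /val_inj. Qed.

Definition standard_embed (lt_lk : (l < k)%N) (psi : tensor R c) :=
  embed_tensor (@widen_ord_injective (ltnW lt_lk)) psi.

End Embedding.

(* Main.v *)
Require Import Defs.
From HB Require Import structures.
From mathcomp Require Import boolp classical_sets reals constructive_ereal ereal exp.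
From mathcomp Require Import all_boot all_order all_algebra all_fingroup.
From mathcomp Require Import pgroup mxrepresentation spectral.
From mathcomp Require Import complex.

Set Implicit Arguments.
Unset Strict Implicit.
Unset Printing Implicit Defensive.

Import GroupScope Order.TTheory GRing.Theory Num.Theory.
Local Open Scope ring_scope.
Local Open Scope sesquilinear_scope.

(** Only the legs at the positions [s j] carry anything: each other leg is C^1,
    so [pull], which forgets those coordinates, is a bijection between the
    basis indices of the embedded tensor and those of psi. Cutting the k legs
    along b = {S, ~: S} therefore amounts to cutting the l legs along the
    preimages of S and of its complement. Either both preimages are nonempty
    and they form the bipartition [restrict_bip s b], or the cut separates
    nothing and contributes entropy 0 to both functionals. A distribution theta
    on bipartitions of the k legs thus enters only through its [marginal], the
    image measure on bipartitions of the l legs, whose mass m may be smaller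
    than 1. Its support is laminar again, because taking preimages preserves
    inclusions. The theorem follows from
      [log_lower theta psi~ = log_lower marginal psi]  ([log_lower_embed]) and
      [log_upper theta psi~ = log_upper marginal psi]  ([log_upper_embed]),
    after division of the marginal by m; if m = 0 both sides vanish.

    For the lower functional, an invertible matrix on C^1 is a nonzero scalar
    and does not change the normalised reduced states, so it suffices to compare
    entropies of marginals of one tensor. The von Neumann entropy depends only
    on the nonzero part of the spectrum, hence is the same for A B and B A
    whenever both are normal. This turns the reduced state into a matrix indexed
    by the basis indices themselves ([spectral_kernel]), for which both the
    passage from S to its complement and the reindexing by [pull] are immediate.

    For the upper functional, the isotypic projector P_lambda^(V_S) is written
    as a sum over the symmetric group of a(t) times the permutation t of the
    factors of V_S, where a is the coefficient function of a central idempotent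
    of the group algebra and depends neither on S nor on the tensor format
    ([isotypic_projE]). All the properties that are needed can be read off a.
    It is a class function, so projectors for nested S commute; each permutation
    is conjugate to its inverse, so the projector is the same for S and ~: S on
    symmetric tensors; and its sum is 1 if lambda = (n) and 0 for the other
    partitions, so a cut that separates nothing forces lambda = (n), of entropy
    0. Finally several b may restrict to the same bipartition b0 of the l legs.
    A tuple for the l legs is copied to all of them, since the projectors are
    commuting idempotents; conversely, among the partitions that a tuple for
    the k legs attaches to the b above b0, one of largest entropy is kept, which
    does not lower the value. *)

(** * Orthogonal projectors and idempotents *)

Section OrthogonalProjection.
Variables (C : numClosedFieldType) (n : nat).
Implicit Types A E : 'M[C]_n.

Lemma mulmx_adj_eq0 m (A : 'M[C]_(m, n)) : A *m A^t* = 0 -> A = 0.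
Proof.
move=> AA; apply/row_matrixP => i; rewrite row0; apply/eqP.
rewrite -(dnorm_eq0 (@dotmx C n)) /= dotmxE.
have -> : (row i A *m (row i A)^t*) 0 0 = (A *m A^t*) i i.
  by rewrite !mxE; apply: eq_bigr => j _; rewrite !mxE.
by rewrite AA mxE.
Qed.

(** A normal matrix and its adjoint have the same kernel; applied to an
    idempotent, which kills the rows of 1 - E, this gives E^t* = E E^t*. *)
Lemma normal_idempotent_hermitian E :
  E *m E = E -> E *m E^t* = E^t* *m E -> E^t* = E.
Proof.
move=> EE nE.
have adjM X Y : (X *m Y : 'M[C]_n)^t* = Y^t* *m X^t*.
  by rewrite trmx_mul map_mxM.
have K0 : (1%:M - E) *m E^t* = 0.
  apply: mulmx_adj_eq0; rewrite adjM trmxCK.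
  rewrite mulmxA -(mulmxA _ _ E) -nE mulmxA mulmxBl mul1mx EE subrr.
  by rewrite !mul0mx.
have E1 : E^t* = E *m E^t*.
  by apply/eqP; rewrite -subr_eq0 -{1}[E^t*]mul1mx -mulmxBl K0.
have : (E *m E^t*)^t* = E *m E^t* by rewrite adjM trmxCK.
by rewrite -E1 trmxCK.
Qed.

Lemma proj_ortho_unique m (U : 'M[C]_(m, n)) E :
  E^t* = E -> U *m E = U -> (E <= U)%MS -> proj_ortho U = E.
Proof.
move=> hE UE EU.
have EE : E *m E = E by case/submxP: EU => D eE; rewrite {1}eE -mulmxA UE.
have PE : proj_ortho U *m E = proj_ortho U.
  have /submxP [D ->] : (proj_ortho U <= U)%MS by rewrite proj_orthoE.
  by rewrite -mulmxA UE.
have : (1%:M - proj_ortho U) *m E = 0.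
  have := proj_ortho_compl_sub U 1%:M; rewrite mul1mx => /orthomx1P Uo.
  case/submxP: EU => D eE; rewrite -hE eE trmx_mul map_mxM mulmxA.
  by rewrite Uo mul0mx.
by rewrite mulmxBl mul1mx PE => /eqP; rewrite subr_eq0 => /eqP ->.
Qed.

End OrthogonalProjection.

(** * Isotypic projectors as elements of the group algebra *)

Section IsotypicIdempotent.
Variables (C : numClosedFieldType) (gT : finGroupType).
Local Notation G := [set: gT]%G.
Variables (m : nat) (rho : mx_representation C G m).

(** If rho is irreducible, then a is the coefficient function of the central
    idempotent of the group algebra that acts as the identity on copies of rho
    and as 0 on the other irreducible representations; otherwise a = 0. *)
Definition isotypic_coefficients (a : gT -> C) : Prop :=
  (forall x y, a (x ^ y)%g = a x) /\
  forall N (rG : mx_representation C G N), mx_irreducible rG ->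
    \sum_x a x *: rG x = (`[< mx_rsim rG rho >])%:R%:M.

Lemma pchar_group : [pchar C]^'.-group G.
Proof.
by apply/pgroupP => p _ _; have := pchar_num C p; rewrite !inE /= => ->.
Qed.

Lemma group_sum_rsim N1 N2 (r1 : mx_representation C G N1)
    (r2 : mx_representation C G N2) (a : gT -> C) b :
  mx_rsim r1 r2 ->
  \sum_x a x *: r2 x = b%:M -> \sum_x a x *: r1 x = b%:M.
Proof.
case=> f e12; move: r2 f; rewrite -{}e12 => r2 f ff hf H.
apply: (row_free_inj ff); rewrite -scalar_mxC -H mulmx_suml mulmx_sumr.
by apply: eq_bigr => x _; rewrite -scalemxAl -scalemxAr hf ?inE.
Qed.

(** The coefficients are those of the Wedderburn idempotent of rho. As the
    identity of a two-sided ideal it is central, which makes its coefficients a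
    class function. *)
Lemma isotypic_coefficients_exist : exists a, isotypic_coefficients a.
Proof.
have [irr|nirr] := pselect (mx_irreducible rho); last first.
  exists (fun=> 0); split=> // N rG irrG.
  rewrite big1 => [|x _]; last by rewrite scale0r.
  case: asboolP => [sim|]; last by rewrite mulr0n raddf0.
  by case: nirr; apply: (mx_rsim_irr sim).
pose sG := DecSocleType (regular_repr C G).
pose i := irr_comp sG rho.
pose e := Wedderburn_id i.
have eR : (e \in group_ring C G)%MS.
  rewrite -(Wedderburn_sum_pchar sG pchar_group) (sumsmx_sup i) //.
  exact: Wedderburn_id_mem.
have /envelop_mxP[a ea] := eR.
have e_central A : (A \in group_ring C G)%MS -> e *m A = A *m e.
  move=> RA; have [_ Ri_e e1 e2] := Wedderburn_is_id_pchar pchar_group i.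
  have /andP[idl idr] := Wedderburn_ideal i.
  have m1 : (e *m A \in Wedderburn_subring i)%MS.
    by apply: (submx_trans _ idr); rewrite mem_mulsmx.
  have m2 : (A *m e \in Wedderburn_subring i)%MS.
    by apply: (submx_trans _ idl); rewrite mem_mulsmx.
  by rewrite -(e2 _ m1) -(e1 _ m2) mulmxA.
have prE (b : gT -> C) x :
    @gring_proj C gT G x (\sum_(y in G) b y *: regular_repr C G y) = (b x)%:M.
  rewrite linear_sum /= (bigD1 x) ?inE //= big1 ?addr0.
    by rewrite linearZ /= gring_projE ?inE // eqxx scalemx1.
  move=> y /andP[_ ne]; rewrite linearZ /= gring_projE ?inE //.
  by rewrite eq_sym (negbTE ne) scaler0.
exists a; split.
  move=> x y; apply/esym.
  have Gy : y \in G by rewrite inE.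
  have e2 : e = \sum_(z in G) a (z ^ y)%g *: regular_repr C G z.
    have -> : e = regular_repr C G y *m e *m regular_repr C G y^-1%g.
      rewrite -e_central ?envelop_mx_id // -mulmxA -repr_mxM ?groupV // mulgV.
      by rewrite repr_mx1 mulmx1.
    rewrite {1}ea mulmx_sumr mulmx_suml (reindex_inj (conjg_inj y)) /=.
    apply: eq_big => z; first by rewrite !inE.
    move=> _; rewrite -scalemxAr -scalemxAl -!repr_mxM ?inE //.
    by congr (_ *: regular_mx _ _ _); rewrite conjgE !mulgA mulgV mul1g mulgK.
  have := prE a x; rewrite -ea e2 prE.
  by move/matrixP/(_ 0 0); rewrite !mxE !mulr1n.
move=> N rG irrG.
have opE N' (r : mx_representation C G N') : gring_op r e = \sum_x a x *: r x.
  rewrite ea linear_sum; apply: eq_big => x; first by rewrite inE.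
  by move=> Gx; rewrite linearZ /= gring_opG.
case: asboolP => [sim|nsim].
  apply: (group_sum_rsim (mx_rsim_trans sim (rsim_irr_comp_pchar sG pchar_group irr))).
  by rewrite -opE op_Wedderburn_id_pchar ?pchar_group.
rewrite mulr0n raddf0 -opE.
apply: (irr_comp'_op0_pchar pchar_group irrG (j := i)); last first.
  exact: Wedderburn_id_mem.
apply/eqP => ei; apply: nsim.
apply: mx_rsim_trans (mx_rsim_sym (rsim_irr_comp_pchar sG pchar_group irr)).
rewrite -/i ei; exact: (rsim_irr_comp_pchar sG pchar_group irrG).
Qed.

(** The group sum E fixes the isotypic component of rho and kills the others,
    so it is the projector along these. In a unitary representation E^t* is
    again a group sum and commutes with the central E; hence E is normal, and
    the projection is orthogonal. *)
Lemma proj_ortho_isotypic (a : gT -> C) N (rG : mx_representation C G N) :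
  isotypic_coefficients a -> (forall x, rG x^-1%g = (rG x)^t*) ->
  proj_ortho
    (\sum_(W : DecSocleType rG | `[< mx_rsim (socle_repr W) rho >]) W)%MS =
  \sum_x a x *: rG x.
Proof.
move=> [ca ha] uG; set U := (X in proj_ortho X); set E := \sum_x _.
have EW (W : DecSocleType rG) :
    W *m E = (`[< mx_rsim (socle_repr W) rho >])%:R *: (W : 'M_N).
  apply/row_matrixP => r; rewrite row_mul linearZ /=.
  have [I [M isoM eW]] := component_mx_def (socle_simple W).
  move: (row r W) (row_sub r W) => v; rewrite /socle_val eW.
  case/sub_sumsmxP=> u ->.
  rewrite mulmx_suml scaler_sumr; apply: eq_bigr => j _.
  have modM : mxmodule rG (M j).
    by apply: mx_iso_module (isoM j) _; case: (socle_simple W).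
  have sim : mx_rsim (submod_repr modM) (socle_repr W).
    by apply/mx_rsim_iso/mx_iso_sym.
  have := group_sum_rsim sim (ha _ _ (socle_irr W)).
  rewrite -{1 2}(in_submodK (submxMl (u j) (M j))).
  move: (in_submod _ _) => w sw.
  transitivity (val_submod (w *m \sum_x a x *: submod_repr modM x)).
    rewrite /E !mulmx_sumr linear_sum; apply: eq_bigr => x _.
    by rewrite -!scalemxAr linearZ /= val_submodJ ?inE.
  by rewrite sw -scalemx1 -scalemxAr mulmx1 linearZ.
have irr1 : (\sum_(W : DecSocleType rG) W = 1%:M)%MS.
  by apply: reducible_Socle1; apply: mx_Maschke_pchar pchar_group.
have UE : U *m E = U.
  suff : (U <= kermx (E - 1%:M))%MS.
    move/sub_kermxP; rewrite mulmxBr mulmx1.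
    by move/eqP; rewrite subr_eq0 => /eqP.
  apply/sumsmx_subP => W sW; apply/sub_kermxP.
  by rewrite mulmxBr mulmx1 EW sW scale1r subrr.
have EU : (E <= U)%MS.
  have : ((\sum_(W : DecSocleType rG) W)%MS *m E <= U)%MS.
    rewrite sumsmxMr; apply/sumsmx_subP => W _; rewrite EW.
    case: (boolP `[< mx_rsim (socle_repr W) rho >]) => sW.
      by rewrite scale1r /U (sumsmx_sup W).
    by rewrite scale0r sub0mx.
  by rewrite irr1 mul1mx.
apply: proj_ortho_unique => //.
have EE : E *m E = E by case/submxP: EU => D eE; rewrite {1}eE -mulmxA UE.
apply: normal_idempotent_hermitian => //.
have Ecom x : E *m rG x = rG x *m E.
  rewrite mulmx_suml mulmx_sumr [RHS](reindex_inj (conjg_inj x)) /=.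
  apply: eq_bigr => y _; rewrite ca -scalemxAl -scalemxAr -!repr_mxM ?inE //.
  by rewrite conjgE !mulgA mulgV mul1g.
have Eadj : E^t* = \sum_x (a x)^* *: rG x^-1%g.
  rewrite linear_sum /= raddf_sum; apply: eq_bigr => x _.
  by rewrite linearZ /= map_mxZ uG.
rewrite Eadj mulmx_sumr mulmx_suml; apply: eq_bigr => x _.
by rewrite -scalemxAl -scalemxAr Ecom.
Qed.

End IsotypicIdempotent.

(** The sum of the coefficients is the action of the idempotent on the trivial
    representation. *)
Lemma isotypic_coefficients_trivial (C : numClosedFieldType) (gT : finGroupType)
    m (rho : mx_representation C [set: gT] m) (a : gT -> C) :
  isotypic_coefficients rho a ->
  \sum_x a x = (`[< m = 1%N /\ forall x, rho x = 1%:M >])%:R.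
Proof.
move=> [_ ha].
have tauP : mx_repr [set: gT] (fun _ : gT => 1%:M : 'M[C]_1).
  by split=> // x y _ _; rewrite mulmx1.
pose tau := MxRepresentation tauP.
have irr : mx_irreducible tau by apply/mx_abs_irrW/linear_mx_abs_irr.
have := ha _ _ irr; rewrite -scaler_suml scalemx1 => /matrixP/(_ 0 0).
rewrite !mxE !mulr1n => ->; congr (nat_of_bool _)%:R.
apply/asboolP/asboolP => [[B e fB hB]|[e t]].
  subst m; split=> // x; rewrite row_free_unit in fB.
  by apply: (can_inj (mulKmx fB)); rewrite -hB ?inE // mul1mx mulmx1.
by subst m; exists 1%:M => // [|x _]; rewrite ?row_free_unit ?unitmx1 //= t.
Qed.

(** * The trivial Specht module *)

Section SpechtTrivial.
Variables (F : fieldType) (n : nat).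
Local Notation aG := (regular_repr F [set: 'S_n]%G).

Lemma gring_vecJ (s t : 'S_n) : gring_vec F s *m aG t = gring_vec F (s * t)%g.
Proof. by rewrite /gring_vec -rowE rowK gring_indexK ?inE. Qed.

Lemma young_symmetrizer_antisymmetric lam t : t \in col_group n lam ->
  young_symmetrizer F n lam *m aG t =
  (-1) ^+ odd_perm t *: young_symmetrizer F n lam.
Proof.
rewrite inE => /forallP ct; rewrite /young_symmetrizer mulmx_suml scaler_sumr.
apply: eq_bigr => p _; rewrite mulmx_suml scaler_sumr.
rewrite [RHS](reindex_inj (mulIg t)) /=; apply: eq_big => q.
  rewrite !inE; apply/forallP/forallP => cq r.
    by rewrite permM (eqP (ct _)).
  by have := cq r; rewrite permM (eqP (ct _)).
move=> _; rewrite -scalemxAl gring_vecJ mulgA odd_permM signr_addb scalerA.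
by rewrite mulrCA -expr2 sqrr_sign mulr1.
Qed.

(** A Specht module is generated by its Young symmetrizer, so it is the trivial
    representation exactly when the symmetrizer is a nonzero invariant. *)
Lemma specht_trivialP lam :
  (\rank (cyclic_mx aG (young_symmetrizer F n lam)) = 1%N /\
   forall s, specht F n lam s = 1%:M) <->
  (young_symmetrizer F n lam != 0 /\
   forall s, young_symmetrizer F n lam *m aG s = young_symmetrizer F n lam).
Proof.
set u := young_symmetrizer F n lam; split=> [[r1 st]|[u0 us]].
  split=> [|s].
    by rewrite -(cyclic_mx_eq0 aG) -mxrank_eq0 r1.
  have := cyclic_mx_id aG u => uc.
  rewrite -(in_submodK uc) -(val_submodJ (cyclic_mx_module aG u)) ?inE //.
  by have := st s; rewrite /specht -/u => ->; rewrite mulmx1.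
have cu : (cyclic_mx aG u <= u)%MS.
  rewrite cyclic_mx_sub //; apply/mxmoduleP => s _.
  by rewrite us.
split=> [|s].
  apply/eqP; rewrite eqn_leq (leq_trans (mxrankS cu) (rank_leq_row _)) /=.
  by rewrite lt0n mxrank_eq0 cyclic_mx_eq0.
rewrite /specht -/u /= /submod_mx.
have e1 : val_submod 1%:M *m aG s = val_submod (U:=cyclic_mx aG u) 1%:M.
  have /submxP[D' ->] : (val_submod (U:=cyclic_mx aG u) 1%:M <= u)%MS.
    exact: submx_trans (val_submodP _) cu.
  by rewrite -mulmxA us.
by rewrite e1 val_submodK.
Qed.

Lemma row_group_one_row (p : 'S_n) : p \in row_group n [:: n].
Proof.
rewrite inE; apply/forallP => m.
have r0 (i : 'I_n) : reshape_index [:: n] i = 0%N.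
  by rewrite /reshape_index /=; case: i => i /= /eqP ->.
by rewrite !r0.
Qed.

Lemma col_group_one_row : col_group n [:: n] = [set 1%g].
Proof.
have c0 (i : 'I_n) : reshape_offset [:: n] i = i.
  rewrite /reshape_offset /reshape_index /=.
  by case: i => i /= /eqP ->; rewrite /= subn0.
apply/setP => q; rewrite !inE.
apply/forallP/eqP => [cq|-> m]; last by rewrite perm1.
by apply/permP => m; apply: val_inj; have /eqP := cq m; rewrite !c0 perm1.
Qed.

Lemma young_symmetrizer_one_rowE :
  young_symmetrizer F n [:: n] = \sum_p gring_vec F p.
Proof.
rewrite /young_symmetrizer col_group_one_row.
apply: eq_big => p; first by rewrite row_group_one_row.
by move=> _; rewrite big_set1 odd_perm1 mulg1 scale1r.
Qed.

Lemma young_symmetrizer_one_row_invariant s :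
  young_symmetrizer F n [:: n] *m aG s = young_symmetrizer F n [:: n].
Proof.
rewrite young_symmetrizer_one_rowE mulmx_suml [RHS](reindex_inj (mulIg s)) /=.
by apply: eq_bigr => p _; rewrite gring_vecJ.
Qed.

Lemma young_symmetrizer_one_row_neq0 : young_symmetrizer F n [:: n] != 0.
Proof.
apply/eqP => /matrixP/(_ 0 (gring_index [set: 'S_n]%G 1%g)).
rewrite young_symmetrizer_one_rowE summxE (bigD1 1%g) //= big1 => [|p p1].
  by rewrite !mxE !eqxx addr0 => /eqP; rewrite oner_eq0.
rewrite mxE eqxx /=; case: eqP => // /(congr1 enum_val).
by rewrite !gring_indexK ?inE // => e; rewrite e eqxx in p1.
Qed.

(** The first cells of the first two rows lie in the same column. *)
Lemma exists_col_transposition lam :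
  (0 < n)%N -> is_partition n lam -> lam != [:: n] ->
  exists2 t, t \in col_group n lam & odd_perm t.
Proof.
move=> n0 /and3P[_ l0 /eqP ln].
case: lam l0 ln => [|a [|b lam]] /=; first by move=> _ n1; rewrite -n1 in n0.
  by rewrite addn0 => _ ->; rewrite eqxx.
rewrite !inE !negb_or ![0%N == _]eq_sym -!lt0n => /and3P[a0 b0 _] ln _.
have an : (a < n)%N by rewrite -ln -{1}[a]addn0 ltn_add2l ltn_addr.
pose i0 : 'I_n := Ordinal n0; pose ia := Ordinal an.
have o0 : reshape_offset (a :: b :: lam) i0 = 0%N by [].
have oa : reshape_offset (a :: b :: lam) ia = 0%N.
  rewrite /reshape_offset /reshape_index /= subSnn /=.
  have -> : (1 - b)%N = 0%N by apply/eqP; rewrite subn_eq0.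
  by rewrite /= addn0 subnn.
exists (tperm i0 ia); last first.
  by rewrite odd_tperm -val_eqE /= eq_sym -lt0n.
by rewrite inE; apply/forallP => m; case: tpermP => [->|->|//]; rewrite o0 oa.
Qed.

End SpechtTrivial.

(** For lam other than (n), a transposition in the column group negates the
    Young symmetrizer, which therefore is not a nonzero invariant. *)
Lemma isotypic_coefficients_specht_sum (C : numClosedFieldType) n lam
    (a : 'S_n -> C) :
  (0 < n)%N -> is_partition n lam -> isotypic_coefficients (specht C n lam) a ->
  \sum_x a x = (lam == [:: n])%:R.
Proof.
move=> n0 plam /isotypic_coefficients_trivial ->; congr (nat_of_bool _)%:R.
apply/asboolP/eqP => [|->]; last first.
  apply/specht_trivialP; split; first exact: young_symmetrizer_one_row_neq0.
  exact: young_symmetrizer_one_row_invariant.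
move/specht_trivialP => [u0 us]; apply/eqP/negPn/negP => nlam.
have [t ct ot] := exists_col_transposition n0 plam nlam.
have := young_symmetrizer_antisymmetric C ct; rewrite us ot expr1 scaleN1r.
move/eqP; rewrite -addr_eq0 -mulr2n -scaler_nat scaler_eq0 (negbTE u0).
by rewrite pnatr_eq0.
Qed.

(** * Projectors for the sides of a bipartition *)

(** Walk each cycle backwards from a chosen base point. *)
Lemma perm_conj_inv (T : finType) (s : {perm T}) : exists t, (s ^ t = s^-1)%g.
Proof.
(* The point s^i r of the orbit with base point r is sent to s^-i r. *)
pose r := froot s; pose i x := findex s (r x) x.
have ri x : (s ^+ i x)%g (r x) = x.
  rewrite permX iter_findex // fconnect_sym; last exact: perm_inj.
  exact: connect_root.
have flip x p q :
    (s ^+ p)%g x = (s ^+ q)%g x <-> (s ^- p)%g x = (s ^- q)%g x.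
  have e1 : (s ^+ (p + q) * s ^- p = s ^+ q)%g by rewrite addnC expgD mulgK.
  have e2 : (s ^+ (p + q) * s ^- q = s ^+ p)%g by rewrite expgD mulgK.
  have e3 : (s ^- p * s ^+ (p + q) = s ^+ q)%g by rewrite expgD mulKg.
  have e4 : (s ^- q * s ^+ (p + q) = s ^+ p)%g by rewrite addnC expgD mulKg.
  split=> e.
    by apply: (@perm_inj _ (s ^+ (p + q))%g); rewrite -!permM e3 e4.
  by have := congr1 (s ^+ (p + q))%g e; rewrite -!permM e3 e4.
pose f x := (s ^- i x)%g (r x).
have sC := fconnect_sym (@perm_inj _ s).
have rs x : r (s x) = r x.
  by apply/eqP; rewrite /r (root_connect sC) sC fconnect1.
have fs x : f (s x) = (s^-1)%g (f x).
  rewrite /f rs -permM -invMg -expgS; apply/flip.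
  by rewrite -{1}rs ri expgSr permM ri.
have f_inj : injective f.
  move=> x y e; have rf z : r (f z) = r z.
    apply/eqP; rewrite /r (root_connect sC) /f -expgVn permX.
    have stepV w : fconnect s ((s^-1)%g w) w.
      by have := fconnect1 s ((s^-1)%g w); rewrite permKV.
    have rr : fconnect s (r z) z by rewrite sC connect_root.
    apply: connect_trans rr; elim: (i z) => [|j IHj] /=; first exact: connect0.
    exact: connect_trans (stepV _) IHj.
  have rxy : r x = r y by rewrite -(rf x) -(rf y) e.
  by rewrite -(ri x) -(ri y) rxy; apply/flip; rewrite -{1}rxy.
exists (perm f_inj).
have e : (s * perm f_inj = perm f_inj * s^-1)%g.
  by apply/permP => x; rewrite !permM ![perm f_inj _]permE fs.
by rewrite conjgE e mulKg.
Qed.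

Section Factors.
Variables (R : realType) (k : nat) (d : 'I_k -> nat) (n : nat).
Local Notation C := R[i].
Local Notation FM := (@factor_mx R k d n).
Implicit Types (S A B : {set 'I_k}) (s t : 'S_n).

Lemma factor_mx_mulP S1 s1 S2 s2 S3 s3 S4 s4 :
  (forall X : {ffun 'I_n -> basis_index d},
     permute_factors S2 s2 (permute_factors S1 s1 X) =
     permute_factors S4 s4 (permute_factors S3 s3 X)) ->
  FM S1 s1 *m FM S2 s2 = FM S3 s3 *m FM S4 s4.
Proof.
move=> e; apply/row_matrixP => r; rewrite !row_mul !rowK -!rowE !rowK.
by rewrite !enum_rankK e.
Qed.

Lemma factor_mx_conj A B s t : A \subset B ->
  FM A s *m FM B t = FM B t *m FM A (s ^ t)%g.
Proof.
move=> /subsetP sAB; apply: factor_mx_mulP => X.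
apply/ffunP => m; apply/ffunP => i; rewrite !ffunE; have [iA|iA] := boolP (i \in A).
  by rewrite (sAB _ iA) -!permM -conjVg conjgE -!mulgA mulgV mulg1.
by case: (i \in B).
Qed.

Lemma factor_mxC A s : FM A s *m FM (~: A) s = FM [set: 'I_k] s.
Proof.
apply/row_matrixP => r; rewrite !row_mul !rowK -!rowE !rowK.
rewrite !enum_rankK; congr (delta_mx _ (enum_rank _)).
apply/ffunP => m; apply/ffunP => i; rewrite !ffunE in_setC in_setT.
by case: (i \in A).
Qed.

Lemma factor_mxM S s t : FM S s *m FM S t = FM S (s * t)%g.
Proof. by have [_ ->] := @factor_mx_repr R k d n S; rewrite ?inE. Qed.

Lemma factor_mx_adj S s : FM S s^-1%g = (FM S s)^t*.
Proof.
apply/matrixP => r c; rewrite !mxE conjC_nat !eqxx /=; congr (nat_of_bool _)%:R.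
apply/eqP/eqP => [->|->]; rewrite enum_rankK -[LHS]enum_valK; congr enum_rank.
  apply/ffunP => m; apply/ffunP => i; rewrite !ffunE.
  by case: (i \in S); rewrite // invgK permKV.
apply/ffunP => m; apply/ffunP => i; rewrite !ffunE.
by case: (i \in S); rewrite // invgK permK.
Qed.

Let T := [set: 'I_k].

Definition specht_coef lam : 'S_n -> C :=
  sval (cid (isotypic_coefficients_exist (specht C n lam))).

Lemma specht_coefP lam :
  isotypic_coefficients (specht C n lam) (specht_coef lam).
Proof. exact: svalP (cid _). Qed.

Lemma specht_coefV lam s : specht_coef lam s^-1%g = specht_coef lam s.
Proof.
by have [t <-] := perm_conj_inv s; have [-> _] := specht_coefP lam.
Qed.

(** The same coefficients serve all sets S of legs and all formats d. *)
Lemma isotypic_projE S lam :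
  isotypic_proj R d n S lam = \sum_s specht_coef lam s *: FM S s.
Proof.
exact: (proj_ortho_isotypic (specht_coefP lam) (rG := factor_repr R d n S)
  (@factor_mx_adj S)).
Qed.

Lemma symmetric_projE :
  symmetric_proj R d n = (n`!%:R)^-1 *: \sum_s FM T s.
Proof.
have n0 : (n`!%:R : C) != 0 by rewrite pnatr_eq0 -lt0n fact_gt0.
apply: proj_ortho_unique.
- rewrite linearZ /= map_mxZ fmorphV /= rmorph_nat; congr (_ *: _).
  rewrite linear_sum /= raddf_sum [RHS](reindex_inj invg_inj) /=.
  by apply: eq_bigr => s _; rewrite factor_mx_adj.
- set U := rfix_mx _ _.
  rewrite -scalemxAr mulmx_sumr (eq_bigr (fun _ => U)).
    by rewrite sumr_const card_Sn -[U *+ _]scaler_nat scalerA mulVf // scale1r.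
  move=> s _.
  have /rfix_mxP fU : (U <= rfix_mx (factor_repr R d n T) [set: 'S_n])%MS by [].
  by rewrite -[RHS](fU s) ?inE.
- apply/rfix_mxP => t _; rewrite -scalemxAl; congr (_ *: _).
  rewrite mulmx_suml [RHS](reindex_inj (mulIg t)) /=.
  by apply: eq_bigr => s _; rewrite /= factor_mxM.
Qed.

Lemma symmetric_proj_fixed s :
  symmetric_proj R d n *m FM T s = symmetric_proj R d n.
Proof.
rewrite symmetric_projE -scalemxAl; congr (_ *: _).
rewrite mulmx_suml [RHS](reindex_inj (mulIg s)) /=.
by apply: eq_bigr => t _; rewrite factor_mxM.
Qed.

Lemma isotypic_proj_invariant A B lam t : A \subset B ->
  isotypic_proj R d n A lam *m FM B t = FM B t *m isotypic_proj R d n A lam.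
Proof.
move=> sAB; rewrite isotypic_projE mulmx_suml mulmx_sumr.
rewrite [RHS](reindex_inj (conjg_inj t)) /=.
apply: eq_bigr => s _; have [-> _] := specht_coefP lam.
by rewrite -scalemxAl -scalemxAr factor_mx_conj.
Qed.

Lemma symmetric_isotypic_comm A lam :
  isotypic_proj R d n A lam *m symmetric_proj R d n =
  symmetric_proj R d n *m isotypic_proj R d n A lam.
Proof.
rewrite symmetric_projE -scalemxAr -scalemxAl mulmx_sumr mulmx_suml.
congr (_ *: _).
by apply: eq_bigr => s _; rewrite isotypic_proj_invariant ?subsetT.
Qed.

Lemma symmetric_proj_idem :
  symmetric_proj R d n *m symmetric_proj R d n = symmetric_proj R d n.
Proof. exact: proj_ortho_proj. Qed.

Lemma isotypic_proj_idem A lam :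
  isotypic_proj R d n A lam *m isotypic_proj R d n A lam =
  isotypic_proj R d n A lam.
Proof. exact: proj_ortho_proj. Qed.

Lemma isotypic_proj_comm A B lam mu : A \subset B ->
  isotypic_proj R d n A lam *m isotypic_proj R d n B mu =
  isotypic_proj R d n B mu *m isotypic_proj R d n A lam.
Proof.
move=> sAB; rewrite (isotypic_projE B) mulmx_sumr mulmx_suml.
by apply: eq_bigr => s _; rewrite -scalemxAr -scalemxAl isotypic_proj_invariant.
Qed.

Lemma isotypic_proj_trivial A lam : (0 < n)%N -> is_partition n lam ->
  (forall s, FM A s = 1%:M) ->
  isotypic_proj R d n A lam = (lam == [:: n])%:R%:M.
Proof.
move=> n0 plam tA; rewrite isotypic_projE.
under eq_bigr do rewrite tA.
rewrite -scaler_suml scalemx1.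
by rewrite (isotypic_coefficients_specht_sum n0 plam (specht_coefP lam)).
Qed.

Lemma tensor_power_symmetric psi :
  tensor_power n psi *m symmetric_proj R d n = tensor_power n psi.
Proof.
apply: proj_ortho_id; apply/rfix_mxP => s _; apply/rowP => c; rewrite !mxE.
rewrite (bigD1 (enum_rank (permute_factors T s^-1%g (enum_val c)))) //=.
rewrite big1 ?addr0 => [|r nr].
  rewrite !mxE enum_rankK eqxx /=.
  have -> : permute_factors T s (permute_factors T s^-1%g (enum_val c)) =
            enum_val c :> {ffun 'I_n -> basis_index d}.
    apply/ffunP => m; apply/ffunP => i.
    by rewrite !ffunE !in_setT invgK permKV.
  rewrite enum_valK eqxx mulr1 (reindex_inj (@perm_inj _ s^-1%g)) /=.
  apply: eq_bigr => m _; congr (psi _).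
  by apply/ffunP => i; rewrite !ffunE in_setT invgK permKV.
rewrite !mxE eqxx /=; case: eqP => [cr|]; last by rewrite mulr0.
case/eqP: nr; rewrite cr enum_rankK -[r in LHS]enum_valK; congr enum_rank.
by apply/ffunP => m; apply/ffunP => i; rewrite !ffunE !in_setT invgK permK.
Qed.

End Factors.

Lemma bipartition_side k (b : bipartition k) :
  [/\ val b = [set side b; ~: side b], side b != set0 & side b != setT].
Proof.
have /existsP[S /and3P[S0 ST /eqP eb]] := valP b.
rewrite /side; case: pickP => [A|] /=; last first.
  by move/(_ S); rewrite eb !inE eqxx.
have S1 : S != setT by apply: contraTneq ST => ->; rewrite properxx.
rewrite eb !inE => /orP[] /eqP ->; split=> //.
- by rewrite setCK setUC.
- by apply: contraNneq S1 => S2; rewrite -[S]setCK S2 setC0.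
- by apply: contraNneq S0 => S2; rewrite -[S]setCK S2 setCT.
Qed.

(** Locked because conversion, when it compares the projectors for two distinct
    sets, would unfold them down to matrix inversion. *)
HB.lock Definition side_proj (R : realType) (k : nat) (d : 'I_k -> nat) (n : nat)
    (A : {set 'I_k}) (lam : seq nat) :=
  symmetric_proj R d n *m isotypic_proj R d n A lam.

Section SideProjectors.
Variables (R : realType) (k : nat) (d : 'I_k -> nat) (n : nat).
Implicit Types (A B : {set 'I_k}) (b : bipartition k).
Local Notation side_proj := (side_proj R d n).

(** On symmetric tensors, permuting the factors of V_A by t amounts to permuting
    those of V_(~: A) by the inverse of t, which has the same coefficient. *)
Lemma side_projC A lam : side_proj (~: A) lam = side_proj A lam.
Proof.
rewrite side_proj.unlock !isotypic_projE !mulmx_sumr [RHS](reindex_inj invg_inj) /=.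
apply: eq_bigr => s _; rewrite specht_coefV -!scalemxAr; congr (_ *: _).
rewrite -[in LHS](symmetric_proj_fixed R d s^-1%g) -(factor_mxC R d A) -!mulmxA.
have [e1 _] := @factor_mx_repr R k d n (~: A).
by rewrite factor_mxM mulVg e1 mulmx1.
Qed.

Lemma bip_proj_side b A lam : A \in val b ->
  bip_proj R d n b lam = side_proj A lam.
Proof.
have e : bip_proj R d n b lam = side_proj (side b) lam.
  by rewrite side_proj.unlock.
have [eb _ _] := bipartition_side b; rewrite eb !inE => /orP[] /eqP ->.
  exact: e.
by rewrite side_projC e.
Qed.

Lemma side_proj_mul A B lam mu :
  side_proj A lam *m side_proj B mu =
  symmetric_proj R d n *m (isotypic_proj R d n A lam *m isotypic_proj R d n B mu).
Proof.
rewrite side_proj.unlock.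
move: (@symmetric_proj_idem R k d n) (@symmetric_isotypic_comm R k d n A lam).
move: (symmetric_proj R d n) (isotypic_proj R d n A lam) => P Q PP QP.
by rewrite mulmxA -(mulmxA P Q) QP !mulmxA PP.
Qed.

Lemma side_proj_comm A B lam mu : A \subset B ->
  side_proj A lam *m side_proj B mu = side_proj B mu *m side_proj A lam.
Proof.
move=> sAB; rewrite !side_proj_mul.
move: (isotypic_proj_comm R d n lam mu sAB).
by move: (isotypic_proj R d n A lam) (isotypic_proj R d n B mu) => P Q ->.
Qed.

Lemma side_proj_idem A lam :
  side_proj A lam *m side_proj A lam = side_proj A lam.
Proof. by rewrite side_proj_mul isotypic_proj_idem side_proj.unlock. Qed.

Lemma side_proj_symmetric A lam :
  side_proj A lam *m symmetric_proj R d n = side_proj A lam.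
Proof.
rewrite side_proj.unlock -mulmxA symmetric_isotypic_comm mulmxA.
by rewrite symmetric_proj_idem.
Qed.

Lemma symmetric_side_proj A lam :
  symmetric_proj R d n *m side_proj A lam = side_proj A lam.
Proof. by rewrite side_proj.unlock mulmxA symmetric_proj_idem. Qed.

End SideProjectors.

(** * Products of commuting idempotents *)

Section CommutingProducts.
Variables (F : fieldType) (N : nat).
Implicit Types (v : 'rV[F]_N) (Z X : 'M[F]_N).

Lemma mulmx_prod_comm (I : finType) (P : pred I) (D : I -> 'M[F]_N) X :
  (forall i, P i -> X *m D i = D i *m X) ->
  X *m \big[mulmx/1%:M]_(i | P i) D i = \big[mulmx/1%:M]_(i | P i) D i *m X.
Proof.
move=> XD; elim/big_rec: _ => [|i Y Pi IH]; first by rewrite mulmx1 mul1mx.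
by rewrite mulmxA XD // -mulmxA IH mulmxA.
Qed.

Lemma mulmx_prod_absorb (I : finType) (P : pred I) (D : I -> 'M[F]_N) i :
  (forall j, P j -> D i *m D j = D j *m D i) -> D i *m D i = D i -> P i ->
  \big[mulmx/1%:M]_(i | P i) D i *m D i = \big[mulmx/1%:M]_(i | P i) D i.
Proof.
move=> Dc Di Pi; rewrite -mulmx_prod_comm //.
have : i \in index_enum I by rewrite mem_index_enum.
elim: (index_enum I) => [//|j r IH]; rewrite inE big_cons.
case: eqP => [<- _|_ /= ir]; first by rewrite Pi mulmxA Di.
case: ifP => [Pj|_]; last exact: IH.
by rewrite mulmxA Dc // -mulmxA IH.
Qed.

Lemma mulmx_prod_fixed (I : finType) (P : pred I) (D : I -> 'M[F]_N) v :
  (forall i, P i -> v *m D i = v) -> v *m \big[mulmx/1%:M]_(i | P i) D i = v.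
Proof.
move=> vD; elim/big_rec: _ => [|i Y Pi IH]; first by rewrite mulmx1.
by rewrite mulmxA vD.
Qed.

(** The image v *m X of v under the first product is fixed by every D i, hence
    by every B j; so (v *m X) *m Y = v *m X for the second product Y, and the
    left-hand side is (v *m Y) *m X. The projector Z records an invariance of v
    that may be needed to compare the B j with the D i. *)
Lemma commuting_product_transfer (I J : finType) (P : pred I) (Q : pred J)
    (D : I -> 'M[F]_N) (B : J -> 'M[F]_N) Z v :
  (forall i i', P i -> P i' -> D i *m D i' = D i' *m D i) ->
  (forall i, P i -> D i *m D i = D i) ->
  (forall i j, P i -> Q j -> D i *m B j = B j *m D i) ->
  (forall i, P i -> Z *m D i = D i *m Z) ->
  v *m Z = v ->
  (forall u : 'rV_N, u *m Z = u -> (forall i, P i -> u *m D i = u) ->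
     forall j, Q j -> u *m B j = u) ->
  v *m \big[mulmx/1%:M]_(i | P i) D i != 0 ->
  v *m \big[mulmx/1%:M]_(j | Q j) B j != 0.
Proof.
move=> DD Di DB ZD vZ H.
pose X := \big[@mulmx F N N N/1%:M]_(i | P i) D i.
pose Y := \big[@mulmx F N N N/1%:M]_(j | Q j) B j; rewrite -/X -/Y.
apply: contraNneq => Y0; have <- : v *m X *m Y = v *m X.
  apply: mulmx_prod_fixed => j Qj; apply: H Qj.
    by rewrite -mulmxA -mulmx_prod_comm // mulmxA vZ.
  move=> i Pi; rewrite -mulmxA mulmx_prod_absorb //; last exact: Di.
  by move=> i' Pi'; apply: DD.
rewrite -mulmxA mulmx_prod_comm; first by rewrite mulmxA Y0 mul0mx.
by move=> j Qj; rewrite -mulmx_prod_comm // => i Pi; rewrite DB.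
Qed.

End CommutingProducts.

(** * The embedded tensor *)

Section Embed.
Variables (R : realType) (l k : nat) (c : 'I_l -> nat).
Variables (s : 'I_l -> 'I_k) (s_inj : injective s).
Local Notation d := (embed_format c s).
Local Notation C := R[i].

Definition pull (x : basis_index d) : basis_index c :=
  finfun (fun j => cast_ord (embed_formatE c s_inj j) (x (s j))).

Lemma pullE x j : pull x j = x (s j) :> nat.
Proof. by rewrite /pull ffunE. Qed.

Lemma embed_format_out i : i \notin codom s -> d i = 1%N.
Proof.
by rewrite /embed_format; case: pickP => [j /eqP <-|//]; rewrite codom_f.
Qed.

Lemma coord_out i (z : 'I_(d i)) : i \notin codom s -> z = 0%N :> nat.
Proof.
by case: z => z /= zi ni; move: zi; rewrite embed_format_out //; case: (z).
Qed.

Lemma pull_inj : injective pull.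
Proof.
move=> x y e; apply/ffunP => i; apply: val_inj => /=.
have [/codomP[j ->]|ni] := boolP (i \in codom s); first by rewrite -!pullE e.
by rewrite !coord_out.
Qed.

(** The preimage is given leg by leg through a statement on the values of the
    coordinates, which avoids casts between the equal dimensions. *)
Lemma push_exists (y : basis_index c) i :
  exists u : 'I_(d i), forall j, s j = i -> u = y j :> nat.
Proof.
have [/codomP[j ->]|ni] := boolP (i \in codom s).
  by exists (cast_ord (esym (embed_formatE c s_inj j)) (y j)) => j' /s_inj ->.
exists (cast_ord (esym (embed_format_out ni)) ord0) => j e.
by case/negP: (ni); rewrite -e codom_f.
Qed.

Definition push (y : basis_index c) : basis_index d :=
  finfun (fun i => sval (cid (push_exists y i))).

Lemma pushK : cancel push pull.
Proof.
move=> y; apply/ffunP => j; apply: val_inj; rewrite /= pullE /push ffunE.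
exact: (svalP (cid (push_exists y (s j)))).
Qed.

Lemma pullK : cancel pull push.
Proof. by move=> x; apply: pull_inj; rewrite pushK. Qed.

Lemma embed_tensorE (psi : tensor R c) x :
  embed_tensor s_inj psi x = psi (pull x).
Proof.
rewrite /embed_tensor ffunE -/(pull x) big1 ?mulr1 // => i ni.
by rewrite coord_out.
Qed.

Lemma embed_tensor_eq0 (psi : tensor R c) :
  (embed_tensor s_inj psi == 0) = (psi == 0).
Proof.
apply/eqP/eqP => e; apply/ffunP => x; rewrite [RHS]ffunE.
  by rewrite -[x]pushK -embed_tensorE e ffunE.
by rewrite embed_tensorE e ffunE.
Qed.

Section Power.
Variable n : nat.
Implicit Types (X : {ffun 'I_n -> basis_index d}).
Implicit Types (Y : {ffun 'I_n -> basis_index c}).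
Implicit Types (S : {set 'I_k}) (t : 'S_n).

Definition pull_all X : {ffun 'I_n -> basis_index c} := [ffun m => pull (X m)].
Definition push_all Y : {ffun 'I_n -> basis_index d} := [ffun m => push (Y m)].

Lemma pull_allK : cancel pull_all push_all.
Proof. by move=> X; apply/ffunP => m; rewrite !ffunE pullK. Qed.

Lemma push_allK : cancel push_all pull_all.
Proof. by move=> X; apply/ffunP => m; rewrite !ffunE pushK. Qed.

Definition reindex_mx : 'M[C]_(#|{: {ffun 'I_n -> basis_index d}}|,
                               #|{: {ffun 'I_n -> basis_index c}}|) :=
  \matrix_r delta_mx 0 (enum_rank (pull_all (enum_val r))).

Lemma reindex_mx_inj m : injective (fun v : 'M_(m, _) => v *m reindex_mx).
Proof.
apply: row_free_inj; apply/row_freeP.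
exists (\matrix_r delta_mx 0 (enum_rank (push_all (enum_val r)))).
apply/row_matrixP => r; rewrite row_mul rowK -rowE rowK row1 enum_rankK.
by rewrite pull_allK enum_valK.
Qed.

Lemma factor_reindex S t :
  factor_mx R d S t *m reindex_mx = reindex_mx *m factor_mx R c (s @^-1: S) t.
Proof.
apply/row_matrixP => r; rewrite !row_mul !rowK -!rowE !rowK !enum_rankK.
congr (delta_mx _ (enum_rank _)); apply/ffunP => m; apply/ffunP => j.
by apply: val_inj; rewrite !ffunE /= !inE; case: ifP.
Qed.

Lemma isotypic_reindex S lam :
  isotypic_proj R d n S lam *m reindex_mx =
  reindex_mx *m isotypic_proj R c n (s @^-1: S) lam.
Proof.
rewrite !isotypic_projE mulmx_suml mulmx_sumr; apply: eq_bigr => t _.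
by rewrite -scalemxAl -scalemxAr factor_reindex.
Qed.

Lemma symmetric_reindex :
  symmetric_proj R d n *m reindex_mx = reindex_mx *m symmetric_proj R c n.
Proof.
rewrite !symmetric_projE -scalemxAl -scalemxAr mulmx_suml mulmx_sumr.
congr (_ *: _); apply: eq_bigr => t _.
by rewrite factor_reindex preimsetT.
Qed.

Lemma tensor_power_reindex (psi : tensor R c) :
  tensor_power n (embed_tensor s_inj psi) *m reindex_mx = tensor_power n psi.
Proof.
apply/rowP => q; rewrite !mxE (bigD1 (enum_rank (push_all (enum_val q)))) //=.
rewrite big1 ?addr0 => [|r nr].
  rewrite !mxE enum_rankK push_allK enum_valK !eqxx mulr1.
  by apply: eq_bigr => m _; rewrite embed_tensorE ffunE pushK.
rewrite !mxE eqxx /=; case: eqP => [qr|]; last by rewrite mulr0.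
by case/eqP: nr; rewrite qr enum_rankK pull_allK enum_valK.
Qed.

End Power.

(** [None] if one side of b contains all the legs that come from psi. *)
Definition restrict_bip (b : bipartition k) : option (bipartition l) :=
  insub [set s @^-1: side b; ~: (s @^-1: side b)].

Lemma restrict_bipP b b0 : restrict_bip b = Some b0 ->
  val b0 = [set s @^-1: side b; ~: (s @^-1: side b)].
Proof. by rewrite /restrict_bip; case: insubP => // u _ eu [<-]. Qed.

Lemma restrict_bip_None b : restrict_bip b = None ->
  s @^-1: side b = set0 \/ ~: (s @^-1: side b) = set0.
Proof.
rewrite /restrict_bip; case: insubP => // nb _.
have [->|S0] := eqVneq (s @^-1: side b) set0; first by left.
have [ST|ST] := eqVneq (s @^-1: side b) setT; first by right; rewrite ST setCT.
case/existsP: nb; exists (s @^-1: side b).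
by rewrite S0 properT ST eqxx.
Qed.

Lemma mem_restrict_bip b b0 A : restrict_bip b = Some b0 -> A \in val b ->
  s @^-1: A \in val b0.
Proof.
move=> /restrict_bipP ->; have [-> _ _] := bipartition_side b.
by rewrite !inE => /orP[] /eqP ->; rewrite ?preimsetC eqxx ?orbT.
Qed.

Lemma restrict_bip_laminar b b' b0 b0' : restrict_bip b = Some b0 ->
  restrict_bip b' = Some b0' -> mutually_laminar b b' -> mutually_laminar b0 b0'.
Proof.
move=> rb rb' /exists_inP[A Ab /exists_inP[B Bb AB]].
apply/exists_inP; exists (s @^-1: A); first exact: mem_restrict_bip Ab.
apply/exists_inP; exists (s @^-1: B); first exact: mem_restrict_bip Bb.
exact: preimsetS.
Qed.

Lemma restrict_bip_proj n b b0 lam : restrict_bip b = Some b0 ->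
  bip_proj R c n b0 lam = side_proj R c n (s @^-1: side b) lam.
Proof.
by move=> rb; apply: bip_proj_side; rewrite (restrict_bipP rb) !inE eqxx.
Qed.

Lemma restrict_bip_side_proj_comm n b b' lam mu : mutually_laminar b b' ->
  side_proj R c n (s @^-1: side b) lam *m side_proj R c n (s @^-1: side b') mu =
  side_proj R c n (s @^-1: side b') mu *m side_proj R c n (s @^-1: side b) lam.
Proof.
have sideE (a : bipartition k) A nu : A \in val a ->
    side_proj R c n (s @^-1: side a) nu = side_proj R c n (s @^-1: A) nu.
  have [e _ _] := bipartition_side a; rewrite e !inE => /orP[] /eqP -> //.
  by rewrite preimsetC side_projC.
move=> /exists_inP[A Ab /exists_inP[B Bb AB]].
by rewrite (sideE _ _ _ Ab) (sideE _ _ _ Bb) side_proj_comm // preimsetS.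
Qed.

Lemma factor_mx0 n t : factor_mx R c (n := n) set0 t = 1%:M.
Proof.
apply/row_matrixP => r; rewrite rowK row1 -[r in RHS]enum_valK.
congr (delta_mx _ (enum_rank _)); apply/ffunP => m; apply/ffunP => j.
by rewrite !ffunE inE.
Qed.

(** A cut that separates nothing is represented by the empty set of legs, on
    which permutations act trivially. *)
Lemma side_proj_trivial n b lam : (0 < n)%N -> is_partition n lam ->
  restrict_bip b = None ->
  side_proj R c n (s @^-1: side b) lam =
  (lam == [:: n])%:R *: symmetric_proj R c n.
Proof.
move=> n0 plam rb.
have -> : side_proj R c n (s @^-1: side b) lam = side_proj R c n set0 lam.
  by case: (restrict_bip_None rb) => e; rewrite -?e // side_projC.
rewrite side_proj.unlock isotypic_proj_trivial // ?mul_mx_scalar // => t.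
exact: factor_mx0.
Qed.

Lemma embed_power_prod_eq0 n (psi : tensor R c) (P : pred (bipartition k)) lam :
  (tensor_power n (embed_tensor s_inj psi) *m
     \big[mulmx/1%:M]_(b | P b) bip_proj R d n b (lam b) == 0) =
  (tensor_power n psi *m
     \big[mulmx/1%:M]_(b | P b) side_proj R c n (s @^-1: side b) (lam b) == 0).
Proof.
have eb b : bip_proj R d n b (lam b) *m reindex_mx n =
            reindex_mx n *m side_proj R c n (s @^-1: side b) (lam b).
  rewrite side_proj.unlock /bip_proj -mulmxA isotypic_reindex mulmxA.
  by rewrite symmetric_reindex -mulmxA.
have e : \big[mulmx/1%:M]_(b | P b) bip_proj R d n b (lam b) *m reindex_mx n =
    reindex_mx n *m
      \big[mulmx/1%:M]_(b | P b) side_proj R c n (s @^-1: side b) (lam b).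
  elim/big_rec2: _ => [|b X Y _ IH]; first by rewrite mulmx1 mul1mx.
  by rewrite -mulmxA IH mulmxA eb mulmxA.
rewrite -(inj_eq (@reindex_mx_inj n 1)) /= mul0mx.
by rewrite -mulmxA e mulmxA tensor_power_reindex.
Qed.

End Embed.

(** * Entropy and the nonzero spectrum *)

Section SameSpectrum.
Variable F : fieldType.
Implicit Types p q r : {poly F}.

(** For characteristic polynomials: the matrices, possibly of different sizes,
    have the same nonzero eigenvalues with multiplicity. *)
Definition same_nonzero_roots p q := exists a b, 'X^a * p = 'X^b * q.

Lemma same_nonzero_roots_sym p q :
  same_nonzero_roots p q -> same_nonzero_roots q p.
Proof. by case=> a [b e]; exists b, a. Qed.

Lemma same_nonzero_roots_trans p q r :
  same_nonzero_roots p q -> same_nonzero_roots q r -> same_nonzero_roots p r.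
Proof.
move=> [a [b e]] [a' [b' e']]; exists (a' + a)%N, (b + b')%N.
by rewrite !exprD -!mulrA e -e' !mulrA ['X^a' * _]mulrC.
Qed.

(** Both sides are 'X^n times the determinant of the block matrix Mx, computed by
    clearing its lower left block from the right or from the left. *)
Lemma char_poly_mulC m n (A : 'M[F]_(m, n)) (B : 'M[F]_(n, m)) :
  'X^n * char_poly (A *m B) = 'X^m * char_poly (B *m A).
Proof.
pose A' := map_mx polyC A; pose B' := map_mx polyC B.
pose Mx := block_mx ('X%:M : 'M_m) A' B' (1%:M : 'M_n).
have e1 : \det Mx = char_poly (A *m B).
  have -> : char_poly (A *m B) = \det (Mx *m block_mx 1%:M 0 (- B') 1%:M).
    rewrite mulmx_block !mulmx1 !mulmx0 !add0r mul1mx subrr det_ublock det1.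
    by rewrite mulr1 mulmxN /char_poly /char_poly_mx map_mxM.
  by rewrite det_mulmx det_lblock !det1 !mulr1.
have e2 : 'X^n * \det Mx = 'X^m * char_poly (B *m A).
  transitivity (\det (block_mx 1%:M 0 (- B') ('X%:M : 'M_n) *m Mx)).
    by rewrite det_mulmx det_lblock det1 mul1r det_scalar.
  rewrite mulmx_block !mul1mx !mul0mx !addr0 mulmx1.
  have -> : - B' *m 'X%:M + 'X%:M *m B' = 0.
    by rewrite mulNmx scalar_mxC addNr.
  by rewrite det_ublock det_scalar mulNmx addrC /char_poly /char_poly_mx map_mxM.
by rewrite -e1 e2.
Qed.

Lemma char_poly_mulmxC m n (A : 'M[F]_(m, n)) (B : 'M[F]_(n, m)) :
  same_nonzero_roots (char_poly (A *m B)) (char_poly (B *m A)).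
Proof. by exists n, m; apply: char_poly_mulC. Qed.

Lemma char_poly_tr n (A : 'M[F]_n) : char_poly A^T = char_poly A.
Proof.
rewrite /char_poly -det_tr /char_poly_mx linearB /= tr_scalar_mx.
by rewrite -map_trmx trmxK.
Qed.

End SameSpectrum.

Section VonNeumann.
Variable R : realType.
Local Notation C := R[i].

Lemma char_poly_spectral n (A : 'M[C]_n) : A \is normalmx ->
  char_poly A =
  \prod_(x <- [seq spectral_diag A 0 j | j <- enum 'I_n]) ('X - x%:P).
Proof.
move=> /orthomx_spectralP eA; rewrite big_map big_enum /=.
have -> : \prod_i ('X - (spectral_diag A 0 i)%:P) =
          char_poly (diag_mx (spectral_diag A)).
  rewrite char_poly_trig ?diag_mx_is_trig //.
  by apply: eq_bigr => i _; rewrite !mxE eqxx mulr1n.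
apply: (@mulfI _ 'X^n); first by rewrite monic_neq0 ?monicXn.
rewrite {1}eA -mulmxA char_poly_mulC -mulmxA mulmxV ?mulmx1 //.
exact: spectral_unit.
Qed.

(** Eigenvalues 0 do not contribute to the entropy. *)
Lemma von_neumann_eq m n (A : 'M[C]_m) (B : 'M[C]_n) :
  A \is normalmx -> B \is normalmx ->
  same_nonzero_roots (char_poly A) (char_poly B) -> von_neumann A = von_neumann B.
Proof.
move=> nA nB [a [b]]; rewrite !char_poly_spectral //.
set sA := [seq _ | j <- enum 'I_m]; set sB := [seq _ | j <- enum 'I_n].
have pad (e : nat) (t : seq C) : 'X^e * \prod_(x <- t) ('X - x%:P) =
    \prod_(x <- nseq e 0 ++ t) ('X - x%:P).
  by rewrite big_cat /= big_nseq polyC0 subr0 -Monoid.iteropE.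
rewrite !pad => /prod_XsubC_eq pe.
have H (e : nat) (t : seq C) :
    \sum_(x <- nseq e 0 ++ t) (complex.Re x * log2 (complex.Re x) : R) =
    \sum_(x <- t) complex.Re x * log2 (complex.Re x).
  by rewrite big_cat /= big_nseq /= mul0r iter_addr_0 mul0rn add0r.
rewrite /von_neumann /shannon !big_map; congr (- _).
have := H a sA; have := H b sB; rewrite (perm_big _ pe) /= => ->.
by rewrite !big_map.
Qed.

Lemma von_neumann1 : von_neumann (1%:M : 'M[C]_1) = 0.
Proof.
have n1 : (1%:M : 'M[C]_1) \is normalmx.
  by apply/normalmxP; rewrite mul1mx mulmx1.
have := char_poly_spectral n1.
have -> : char_poly (1%:M : 'M[C]_1) = \prod_(x <- [:: 1]) ('X - x%:P).
  rewrite big_seq1 char_poly_trig ?scalar_mx_is_trig // big_ord1.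
  by rewrite mxE eqxx.
move/prod_XsubC_eq => pe; rewrite /von_neumann /shannon big_map.
have := perm_big (op := GRing.add) (x := 0) (P := predT)
  (F := fun x : C => complex.Re x * log2 (complex.Re x) : R) _ pe.
rewrite big_seq1 !big_map => /= <-.
by rewrite mul1r /log2 ln1 mul0r oppr0.
Qed.

Lemma von_neumann0 m : von_neumann (0 : 'M[C]_m) = 0.
Proof.
have n0 p : (0 : 'M[C]_p) \is normalmx.
  by apply/normalmxP; rewrite mul0mx trmx0 map_mx0 mulmx0.
transitivity (von_neumann (0 : 'M[C]_0)); last first.
  by rewrite /von_neumann /shannon big_map big_enum big_ord0 oppr0.
apply: von_neumann_eq => //.
have <- : (0 : 'M_(m, 0)) *m (0 : 'M[C]_(0, m)) = 0 by rewrite mul0mx.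
have <- : (0 : 'M_(0, m)) *m (0 : 'M[C]_(m, 0)) = 0 by rewrite mul0mx.
exact: char_poly_mulmxC.
Qed.

End VonNeumann.

(** * Reduced states on basis indices *)

Section SpectralKernel.
Variables (R : realType) (k : nat) (d : 'I_k -> nat).
Local Notation C := R[i].
Local Notation X := (basis_index d).
Implicit Types (psi : tensor R d) (S : {set 'I_k}).

Definition agree S (x y : X) : bool := [forall i, (i \in S) ==> (x i == y i)].

Lemma restrict_index_eq S (x y : X) :
  (restrict_index S x == restrict_index S y) = agree S x y.
Proof.
apply/eqP/forall_inP => [e i iS|e].
  by have /ffunP/(_ (exist _ i iS)) := e; rewrite !ffunE => ->.
by apply/ffunP => i; rewrite !ffunE; apply/eqP/e; exact: valP i.
Qed.

Definition agree_mx S : 'M[C]_#|{: X}| :=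
  \matrix_(r, q) (agree S (enum_val r) (enum_val q))%:R.

Definition weight_mx psi : 'M[C]_#|{: X}| := diag_mx (\row_r psi (enum_val r)).

(** With F and G the restriction matrices to S and ~: S and D the diagonal matrix
    of psi, the flattening is F^T D G. Moving F^T to the end of
    (F^T D G) (F^T D G)^t* leaves D (G G^T) D^t* (F F^T), a matrix on basis
    indices in which S enters only through the relations of agreeing on S and
    on ~: S. *)
Definition spectral_kernel S psi : 'M[C]_#|{: X}| :=
  (norm2sq psi)^-1 *:
    (weight_mx psi *m agree_mx (~: S) *m (weight_mx psi)^t* *m agree_mx S).

Definition restriction_mx S :
    'M[C]_(#|{: X}|,
           #|{: {dffun forall i : {i : 'I_k | i \in S}, 'I_(d (val i))}}|) :=
  \matrix_r delta_mx 0 (enum_rank (restrict_index S (enum_val r))).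

Lemma restriction_mxE S :
  restriction_mx S *m (restriction_mx S)^T = agree_mx S.
Proof.
apply/matrixP => r q; rewrite !mxE.
rewrite (bigD1 (enum_rank (restrict_index S (enum_val r)))) //=.
rewrite !mxE !eqxx mul1r big1 ?addr0 => [|j nj].
  by rewrite (inj_eq enum_rank_inj) restrict_index_eq.
by rewrite !mxE (negbTE nj) mul0r.
Qed.

Lemma restriction_mx_real S : (restriction_mx S)^t* = (restriction_mx S)^T.
Proof. by apply/matrixP => r q; rewrite !mxE conjC_nat. Qed.

Lemma restriction_mx_tr_real S : ((restriction_mx S)^T)^t* = restriction_mx S.
Proof. by apply/matrixP => r q; rewrite !mxE conjC_nat. Qed.

Lemma flatteningE S psi :
  flattening S psi =
  (restriction_mx S)^T *m weight_mx psi *m restriction_mx (~: S).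
Proof.
apply/matrixP => a b; rewrite /flattening /weight_mx summxE !mxE.
rewrite (reindex (@enum_val X predT)) /=; last exact: onW_bij (enum_val_bij _).
apply: eq_bigr => r _; rewrite mul_mx_diag !mxE !eqxx /=.
by rewrite -mulnb natrM mulrA [_ * psi _]mulrC.
Qed.

Lemma char_poly_density S psi :
  same_nonzero_roots (char_poly (density_mx S psi))
                     (char_poly (spectral_kernel S psi)).
Proof.
have adjM m n p (A : 'M[C]_(m, n)) (B : 'M[C]_(n, p)) :
    (A *m B)^t* = B^t* *m A^t*.
  by rewrite trmx_mul map_mxM.
set nu := (norm2sq psi)^-1; set D := weight_mx psi.
set F := restriction_mx S; set G := restriction_mx (~: S).
have -> : density_mx S psi =
          F^T *m (nu *: (D *m agree_mx (~: S) *m D^t* *m F)).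
  rewrite /density_mx flatteningE -/F -/G -/D !adjM.
  rewrite restriction_mx_real restriction_mx_tr_real.
  by rewrite -restriction_mxE -/F -/G -scalemxAr !mulmxA.
apply: same_nonzero_roots_trans (char_poly_mulmxC _ _) _.
rewrite -scalemxAl -(mulmxA _ F) restriction_mxE.
by exists 0%N, 0%N.
Qed.

Lemma density_normal S psi : density_mx S psi \is normalmx.
Proof.
have nr : (norm2sq psi)^-1 \is Num.real.
  by rewrite rpredV /norm2sq ger0_real // sumr_ge0 // => x _; rewrite exprn_ge0.
apply/normalmxP.
have -> : (density_mx S psi)^t* = density_mx S psi; last by [].
rewrite /density_mx linearZ /= map_mxZ; congr (_ *: _).
  exact: (CrealP nr).
by rewrite trmx_mul map_mxM trmxCK.
Qed.

(** The transpose of the kernel for S is the kernel for ~: S up to a cyclic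
    permutation of its factors, all of which are symmetric. *)
Lemma char_poly_kernelC S psi :
  same_nonzero_roots (char_poly (spectral_kernel (~: S) psi))
                     (char_poly (spectral_kernel S psi)).
Proof.
have agT A : (agree_mx A)^T = agree_mx A.
  apply/matrixP => r q; rewrite !mxE; congr (nat_of_bool _)%:R.
  by apply: eq_forallb => i; rewrite eq_sym.
have wT : (weight_mx psi)^T = weight_mx psi by exact: tr_diag_mx.
rewrite -(char_poly_tr (spectral_kernel S psi)) /spectral_kernel setCK wT.
set D := weight_mx psi; set D' := map_mx _ D.
have w'T : D'^T = D' by rewrite /D' map_trmx wT.
move: (_^-1) => nu; rewrite [X in _ _ (char_poly X)]linearZ /=.
rewrite !trmx_mul !agT wT w'T !mulmxA -(mulmxA (_ *m _)) scalemxAr.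
apply: same_nonzero_roots_trans (char_poly_mulmxC _ _) _.
rewrite -scalemxAl !mulmxA.
have -> : nu *: (agree_mx S *m D' *m agree_mx (~: S) *m weight_mx psi) =
          agree_mx S *m (nu *: (D' *m agree_mx (~: S) *m D)).
  by rewrite -scalemxAr !mulmxA.
apply/same_nonzero_roots_sym/(same_nonzero_roots_trans (char_poly_mulmxC _ _)).
by rewrite -scalemxAl; exists 0%N, 0%N.
Qed.

Lemma norm2sq_eq0 psi : (norm2sq psi == 0) = (psi == 0).
Proof.
rewrite /norm2sq psumr_eq0 => [|x _]; last by rewrite exprn_ge0.
apply/allP/eqP => [a0|-> x _]; last by rewrite ffunE normr0 expr0n /= eqxx.
apply/ffunP => x; rewrite ffunE; apply/eqP.
by have := a0 x (mem_index_enum x); rewrite /= expf_eq0 /= normr_eq0.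
Qed.

(** The reduced state on no legs is 1: the agreement relation on the empty set is
    everywhere true, hence of rank one, and the kernel reduces to the 1 x 1
    matrix of the normalised squared norm. *)
Lemma char_poly_kernel_set0 psi : psi != 0 ->
  same_nonzero_roots (char_poly (spectral_kernel set0 psi))
                     (char_poly (1%:M : 'M[C]_1)).
Proof.
move=> psi0; pose u : 'rV[C]_#|{: X}| := const_mx 1.
have e0 : agree_mx set0 = u^T *m u.
  apply/matrixP => r q; rewrite !mxE big_ord1 !mxE mulr1.
  suff -> : agree set0 (enum_val r) (enum_val q) by [].
  by apply/forallP => i; rewrite inE.
have eT : agree_mx (~: set0) = 1%:M.
  apply/matrixP => r q; rewrite !mxE -(inj_eq enum_val_inj).
  congr (nat_of_bool _)%:R; apply/forallP/eqP => [e|-> i]; last by rewrite eqxx implybT.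
  by apply/ffunP => i; have := e i; rewrite !inE => /eqP.
rewrite /spectral_kernel e0 eT mulmx1 mulmxA scalemxAl.
apply: same_nonzero_roots_trans (char_poly_mulmxC _ _) _.
set D := weight_mx psi.
suff -> : u *m ((norm2sq psi)^-1 *: (D *m D^t* *m u^T)) = 1%:M.
  by exists 0%N, 0%N.
apply/matrixP => i j; rewrite !ord1 -scalemxAr !mxE eqxx /=.
have -> : \sum_r u 0 r * (D *m D^t* *m u^T) r 0 = norm2sq psi.
  rewrite /norm2sq [RHS](reindex (@enum_val X predT)) /=; last first.
    exact: onW_bij (enum_val_bij _).
  apply: eq_bigr => r _; rewrite /D /weight_mx tr_diag_mx map_diag_mx.
  by rewrite mulmx_diag mul_diag_mx !mxE mul1r mulr1 -normCK.
by rewrite mulVf // norm2sq_eq0.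
Qed.

End SpectralKernel.

Section ReindexKernel.
Variables (R : realType) (k1 k2 : nat) (d1 : 'I_k1 -> nat) (d2 : 'I_k2 -> nat).
Variables (psi1 : tensor R d1) (psi2 : tensor R d2).
Variable f : basis_index d1 -> basis_index d2.
Hypotheses (fb : bijective f) (e : forall x, psi1 x = psi2 (f x)).

Lemma norm2sq_reindex : norm2sq psi1 = norm2sq psi2.
Proof.
rewrite /norm2sq [RHS](reindex f) /=; last exact: onW_bij.
by apply: eq_bigr => x _; rewrite e.
Qed.

Lemma char_poly_kernel_reindex (S1 : {set 'I_k1}) (S2 : {set 'I_k2}) :
  (forall x y, agree S1 x y = agree S2 (f x) (f y)) ->
  (forall x y, agree (~: S1) x y = agree (~: S2) (f x) (f y)) ->
  same_nonzero_roots (char_poly (spectral_kernel S1 psi1))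
                     (char_poly (spectral_kernel S2 psi2)).
Proof.
move=> eS eSc; have [g fK gK] := fb.
pose W : 'M[R[i]]_(#|{: basis_index d1}|, #|{: basis_index d2}|) :=
  \matrix_r delta_mx 0 (enum_rank (f (enum_val r))).
have WE m (A : 'M_(_, m)) r j :
    (W *m A) r j = A (enum_rank (f (enum_val r))) j.
  have : row r (W *m A) = row (enum_rank (f (enum_val r))) A.
    by rewrite row_mul rowK -rowE.
  by move/rowP/(_ j); rewrite !mxE.
have EW m (A : 'M_(m, _)) i r :
    (A *m W) i r = A i (enum_rank (g (enum_val r))).
  rewrite mxE (bigD1 (enum_rank (g (enum_val r)))) //= big1 ?addr0 => [|q nq].
    by rewrite !mxE enum_rankK gK enum_valK !eqxx mulr1.
  rewrite !mxE eqxx /=; case: eqP => [er|]; last by rewrite mulr0.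
  by case/eqP: nq; rewrite er enum_rankK fK enum_valK.
have agW S S' : (forall x y, agree S x y = agree S' (f x) (f y)) ->
    agree_mx R d1 S *m W = W *m agree_mx R d2 S'.
  by move=> h; apply/matrixP => i r; rewrite EW WE !mxE !enum_rankK h gK.
have diagE (i : 'I_#|{: basis_index d1}|) (r : 'I_#|{: basis_index d2}|) :
    (i == enum_rank (g (enum_val r))) = (enum_rank (f (enum_val i)) == r).
  rewrite -[i == _](inj_eq enum_val_inj) -[_ == r](inj_eq enum_val_inj).
  by rewrite !enum_rankK (can2_eq fK gK).
have wW : weight_mx psi1 *m W = W *m weight_mx psi2.
  by apply/matrixP => i r; rewrite EW WE !mxE !enum_rankK e diagE.
have wcW : (weight_mx psi1)^t* *m W = W *m (weight_mx psi2)^t*.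
  apply/matrixP => i r; rewrite EW WE /weight_mx !tr_diag_mx !mxE.
  by rewrite !enum_rankK e diagE.
pose W' : 'M[R[i]]_(#|{: basis_index d2}|, #|{: basis_index d1}|) :=
  \matrix_r delta_mx 0 (enum_rank (g (enum_val r))).
have WW' : W *m W' = 1%:M.
  apply/row_matrixP => r; rewrite row_mul rowK -rowE rowK row1 enum_rankK fK.
  by rewrite enum_valK.
have W'W : W' *m W = 1%:M.
  apply/row_matrixP => r; rewrite row_mul rowK -rowE rowK row1 enum_rankK gK.
  by rewrite enum_valK.
have kW : spectral_kernel S1 psi1 *m W = W *m spectral_kernel S2 psi2.
  rewrite /spectral_kernel norm2sq_reindex -scalemxAl -scalemxAr.
  congr (_ *: _); rewrite -mulmxA (agW _ _ eS) mulmxA -(mulmxA _ _ W) wcW.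
  by rewrite mulmxA -(mulmxA _ _ W) (agW _ _ eSc) mulmxA wW !mulmxA.
rewrite -[spectral_kernel S1 psi1]mulmx1 -WW' mulmxA kW -mulmxA.
apply: same_nonzero_roots_trans (char_poly_mulmxC _ _) _.
by rewrite -mulmxA W'W mulmx1; exists 0%N, 0%N.
Qed.

End ReindexKernel.

(** * Entropies of the embedded tensor *)

Section EmbedEntropy.
Variables (R : realType) (l k : nat) (c : 'I_l -> nat).
Variables (s : 'I_l -> 'I_k) (s_inj : injective s).
Local Notation d := (embed_format c s).
Implicit Types (psi : tensor R c) (b : bipartition k).

Lemma agree_pull S (x y : basis_index d) :
  agree S x y = agree (s @^-1: S) (pull s_inj x) (pull s_inj y).
Proof.
apply/forall_inP/forall_inP => [e j|e i iS].
  by rewrite inE => /e/eqP e1; rewrite -val_eqE /= !pullE e1.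
have [/codomP[j ej]|ni] := boolP (i \in codom s); last first.
  by rewrite -val_eqE /= !(coord_out _ ni).
subst i; have := e j; rewrite inE => /(_ iS)/eqP e1.
by rewrite -val_eqE /= -!(pullE s_inj) e1.
Qed.

Lemma char_poly_density_embed psi S :
  same_nonzero_roots (char_poly (density_mx S (embed_tensor s_inj psi)))
                     (char_poly (spectral_kernel (s @^-1: S) psi)).
Proof.
apply: same_nonzero_roots_trans (char_poly_density _ _) _.
apply: (char_poly_kernel_reindex (f := @pull l k c s s_inj)).
- exact: (Bijective (pullK s_inj) (pushK s_inj)).
- exact: embed_tensorE.
- exact: agree_pull.
- by move=> x y; rewrite agree_pull preimsetC.
Qed.

Lemma entropy_embed_Some psi b (b0 : bipartition l) :
  restrict_bip s b = Some b0 ->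
  entropy_bip b (embed_tensor s_inj psi) = entropy_bip b0 psi.
Proof.
move=> rb; apply: von_neumann_eq; try exact: density_normal.
apply: same_nonzero_roots_trans (char_poly_density_embed _ _) _.
apply: same_nonzero_roots_trans _ (same_nonzero_roots_sym (char_poly_density _ _)).
have : side b0 \in val b0.
  by have [e _ _] := bipartition_side b0; rewrite e !inE eqxx.
rewrite (restrict_bipP rb) !inE => /orP[] /eqP ->; first by exists 0%N, 0%N.
exact/same_nonzero_roots_sym/char_poly_kernelC.
Qed.

Lemma entropy_embed0 b :
  entropy_bip b (embed_tensor s_inj (0 : tensor R c)) = 0.
Proof.
have /eqP -> : embed_tensor s_inj (0 : tensor R c) == 0.
  by rewrite embed_tensor_eq0.
rewrite /entropy_bip /density_mx.
have -> : flattening (side b) (0 : tensor R d) = 0.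
  by rewrite /flattening big1 // => x _; rewrite ffunE scale0r.
by rewrite mul0mx scaler0 von_neumann0.
Qed.

Lemma entropy_embed_None psi b : restrict_bip s b = None ->
  entropy_bip b (embed_tensor s_inj psi) = 0.
Proof.
move=> rb; have [->|psi0] := eqVneq psi 0; first exact: entropy_embed0.
rewrite -(von_neumann1 R); apply: von_neumann_eq.
- exact: density_normal.
- by apply/normalmxP; rewrite trmx1 map_mx1.
apply: same_nonzero_roots_trans (char_poly_density_embed _ _) _.
apply: same_nonzero_roots_trans _ (char_poly_kernel_set0 psi0).
case: (restrict_bip_None rb) => <-; first by exists 0%N, 0%N.
exact/same_nonzero_roots_sym/char_poly_kernelC.
Qed.

End EmbedEntropy.

(** * The marginal distribution *)

Lemma big_neq0_cond (F : pzRingType) (I : finType) (w h : I -> F) :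
  \sum_(i | w i != 0) w i * h i = \sum_i w i * h i.
Proof.
rewrite big_mkcond; apply: eq_bigr => i _.
by case: eqP => // ->; rewrite mul0r.
Qed.

Lemma shannon_one_row (R : realType) n : (0 < n)%N ->
  shannon [seq (m%:R / n%:R : R) | m <- [:: n]] = 0.
Proof.
move=> n0; rewrite /shannon /= big_seq1 divff ?pnatr_eq0 -?lt0n //.
by rewrite /log2 ln1 !mul0r mulr0 oppr0.
Qed.

Section Marginal.
Variables (R : realType) (l k : nat) (c : 'I_l -> nat).
Variables (s : 'I_l -> 'I_k) (s_inj : injective s).
Variable theta : bipartition k -> R.
Implicit Types (psi : tensor R c) (b : bipartition k).

(** Its total mass is less than 1 if some b in the support of theta restricts to
    no bipartition of the l legs. *)
Definition marginal (b0 : bipartition l) : R :=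
  \sum_(b | restrict_bip s b == Some b0) theta b.

Lemma marginal_sum (h : bipartition l -> R) :
  \sum_b theta b * (if restrict_bip s b is Some b0 then h b0 else 0) =
  \sum_b0 marginal b0 * h b0.
Proof.
under [RHS]eq_bigr do rewrite big_distrl /=.
rewrite (exchange_big_dep predT) //=; apply: eq_bigr => b _.
case: (restrict_bip s b) => [b0|]; last by rewrite mulr0 big_pred0.
by rewrite (eq_bigl (pred1 b0)) ?big_pred1_eq // => b1; rewrite eq_sym.
Qed.

Lemma entropy_mix_embed psi :
  entropy_mix theta (embed_tensor s_inj psi) = entropy_mix marginal psi.
Proof.
rewrite /entropy_mix -marginal_sum; apply: eq_bigr => b _.
case rb: (restrict_bip s b) => [b0|].
  by rewrite (entropy_embed_Some s_inj psi rb).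
by rewrite (entropy_embed_None s_inj psi rb).
Qed.

End Marginal.

(** * The lower functional of the embedded tensor *)

Section LocalAction.
Variables (R : realType).
Local Notation C := R[i].

Lemma entropy_mix_scale k (d : 'I_k -> nat) (theta : bipartition k -> R) (a : C)
    (psi : tensor R d) : a != 0 ->
  entropy_mix theta [ffun x => a * psi x] = entropy_mix theta psi.
Proof.
move=> a0; apply: eq_bigr => b _; congr (_ * von_neumann _).
have fl S : flattening S [ffun x => a * psi x] = a *: flattening S psi.
  rewrite /flattening scaler_sumr; apply: eq_bigr => x _.
  by rewrite ffunE scalerA.
have nn : norm2sq [ffun x => a * psi x] = (a * a^*) * norm2sq psi.
  rewrite /norm2sq mulr_sumr; apply: eq_bigr => x _.
  by rewrite ffunE normrM exprMn normCK.
rewrite /density_mx nn fl linearZ /= map_mxZ -scalemxAl -scalemxAr !scalerA.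
have aa : a * a^* != 0 by rewrite mulf_neq0 // conjC_eq0.
congr (_ *: _).
have cancel3 (x y z : C) : x * y != 0 -> (x * y * z)^-1 * x * y = z^-1.
  by move=> xy; rewrite -mulrA invfM mulrC mulrA mulfV ?mul1r.
exact: cancel3.
Qed.

Lemma castmx_unit m n (e : m = n) (A : 'M[C]_m) :
  A \in unitmx -> castmx (e, e) A \in unitmx.
Proof. by case: _ / e. Qed.

Lemma det_size1 n (A : 'M[C]_n) (u v : 'I_n) : n = 1%N -> A u v = \det A.
Proof. by move=> n1; subst n; rewrite !ord1 det_mx11. Qed.

Variables (l k : nat) (c : 'I_l -> nat).
Variables (s : 'I_l -> 'I_k) (s_inj : injective s).
Local Notation d := (embed_format c s).
Implicit Types (psi : tensor R c).

(** Matrices on the legs C^1 are scalars, equal to their determinants. *)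
Lemma local_action_embed (A : forall i, 'M[C]_(d i)) (B : forall j, 'M[C]_(c j)) psi :
  (forall j (x y : basis_index d),
     A (s j) (x (s j)) (y (s j)) = B j (pull s_inj x j) (pull s_inj y j)) ->
  local_action A (embed_tensor s_inj psi) =
  [ffun x => \prod_(i | i \notin codom s) \det (A i) *
             embed_tensor s_inj (local_action B psi) x].
Proof.
move=> AB; apply/ffunP => x; rewrite [LHS]ffunE [RHS]ffunE embed_tensorE.
rewrite [local_action B psi _]ffunE mulr_sumr.
rewrite [RHS](reindex (pull s_inj)) /=; last first.
  exact: onW_bij (Bijective (pullK s_inj) (pushK s_inj)).
apply: eq_bigr => y _; rewrite embed_tensorE mulrA; congr (_ * _).
rewrite (bigID (fun i => i \in codom s)) /= mulrC; congr (_ * _).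
  by apply: eq_bigr => i ni; apply: det_size1; apply: embed_format_out.
transitivity (\prod_(i in s @: setT) A i (x i) (y i)).
  apply: eq_bigl => i; apply/codomP/imsetP => [[j ->]|[j _ ->]]; by exists j.
rewrite big_imset /=; last by move=> ? ? _ _; apply: s_inj.
by apply: eq_big => j; rewrite ?inE.
Qed.

End LocalAction.

Section Lower.
Variables (R : realType) (l k : nat) (c : 'I_l -> nat).
Variables (s : 'I_l -> 'I_k) (s_inj : injective s).
Local Notation d := (embed_format c s).
Local Notation C := R[i].
Variable theta : bipartition k -> R.

Lemma entropy_mix_local_action_embed (A : forall i, 'M[C]_(d i))
    (B : forall j, 'M[C]_(c j)) (psi : tensor R c) :
  (forall i, A i \in unitmx) ->
  (forall j (x y : basis_index d),
     A (s j) (x (s j)) (y (s j)) = B j (pull s_inj x j) (pull s_inj y j)) ->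
  entropy_mix theta (local_action A (embed_tensor s_inj psi)) =
  entropy_mix (marginal s theta) (local_action B psi).
Proof.
move=> uA AB; rewrite (local_action_embed psi AB) entropy_mix_scale.
  exact: entropy_mix_embed.
by apply/prodf_neq0 => i _; have := uA i; rewrite unitmxE unitfE.
Qed.

(** As for [push_exists], the entries are related through the values of their
    indices. *)
Lemma extend_matrix (B : forall j, 'M[C]_(c j)) i :
  (forall j, B j \in unitmx) ->
  exists M : 'M[C]_(d i), M \in unitmx /\
    forall j, s j = i -> forall (u v : 'I_(d i)) (u' v' : 'I_(c j)),
      u = u' :> nat -> v = v' :> nat -> M u v = B j u' v'.
Proof.
move=> uB; have [/codomP[j ->]|ni] := boolP (i \in codom s); last first.
  exists 1%:M; split=> [|j e]; first exact: unitmx1.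
  by case/negP: (ni); rewrite -e codom_f.
pose e := esym (embed_formatE c s_inj j).
exists (castmx (e, e) (B j)); split; first exact: castmx_unit.
move=> j' /s_inj ej u v; rewrite {j'}ej => u' v' eu ev; rewrite castmxE.
by congr (B j _ _); apply: val_inj.
Qed.

(** Invertible matrices on the legs of psi extend to the embedding by the
    identity and, conversely, those on the embedding restrict. *)
Lemma log_lower_embed (psi : tensor R c) :
  log_lower theta (embed_tensor s_inj psi) = log_lower (marginal s theta) psi.
Proof.
rewrite /log_lower embed_tensor_eq0; case: eqP => // _; congr ereal_sup.
apply/seteqP; split=> _ [A [uA ->]].
  pose e j := embed_formatE c s_inj j.
  exists (fun j => castmx (e j, e j) (A (s j))).
  split=> [j|]; first exact: castmx_unit.
  congr EFin; apply: entropy_mix_local_action_embed => // j x y.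
  by rewrite castmxE; congr (A (s j) _ _); apply: val_inj; rewrite /= pullE.
pose A' i := sval (cid (extend_matrix i uA)).
have A'P i := svalP (cid (extend_matrix i uA)).
exists A'; split=> [i|]; first by case: (A'P i).
congr EFin; apply/esym/entropy_mix_local_action_embed => [i|j x y].
  by case: (A'P i).
by have [_ h] := A'P (s j); apply: h; rewrite ?pullE.
Qed.

End Lower.

(** * Rescaling the weights *)

Section Scale.
Variables (R : realType) (k : nat) (d : 'I_k -> nat) (psi : tensor R d).
Variable theta : bipartition k -> R.

Lemma log_lower_scale m : 0 < m ->
  log_lower (fun b => m * theta b) psi = (m%:E * log_lower theta psi)%E.
Proof.
move=> m0; rewrite /log_lower; case: eqP => _.
  by rewrite gt0_muleNy ?lte_fin.
rewrite -ereal_sup_pZl //; congr ereal_sup.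
have mix phi : entropy_mix (fun b => m * theta b) phi = m * entropy_mix theta phi.
  by rewrite /entropy_mix mulr_sumr; apply: eq_bigr => b _; rewrite mulrA.
apply/seteqP; split=> E.
  move=> [A [uA ->]]; exists (entropy_mix theta (local_action A psi))%:E.
    by exists A.
  by rewrite -EFinM mix.
by move=> [_ [A [uA ->]] <-]; exists A; split=> //; rewrite mix EFinM.
Qed.

Lemma log_upper_scale m : 0 < m ->
  log_upper (fun b => m * theta b) psi = (m%:E * log_upper theta psi)%E.
Proof.
move=> m0; rewrite /log_upper; case: eqP => _.
  by rewrite gt0_muleNy ?lte_fin.
rewrite -ereal_sup_pZl //; congr ereal_sup.
have supp b : (m * theta b != 0) = (theta b != 0).
  by rewrite mulf_eq0 negb_or gt_eqF.
have sum (h : bipartition k -> R) :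
    \sum_(b | m * theta b != 0) m * theta b * h b =
    m * \sum_(b | theta b != 0) theta b * h b.
  by rewrite mulr_sumr; apply: eq_big => b; rewrite ?supp ?mulrA.
apply/seteqP; split=> E.
  move=> [n [lam [n1 plam nz ->]]].
  exists (\sum_(b | theta b != 0)
            theta b * shannon [seq q%:R / n%:R | q <- lam b])%:E.
    exists n, lam; split=> //; first by move=> b; rewrite -supp; apply: plam.
    by rewrite -(eq_bigl _ _ supp).
  by rewrite -EFinM sum.
move=> [_ [n [lam [n1 plam nz ->]]] <-]; exists n, lam; split=> //.
- by move=> b; rewrite supp; apply: plam.
- by rewrite (eq_bigl _ _ supp).
- by rewrite sum EFinM.
Qed.

Lemma log_lower_zero :
  psi != 0 -> (forall b, theta b = 0) -> log_lower theta psi = 0%E.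
Proof.
move=> psi0 t0; rewrite /log_lower (negbTE psi0) -[RHS]ereal_sup1.
congr ereal_sup; have mix phi : entropy_mix theta phi = 0.
  by rewrite /entropy_mix big1 // => b _; rewrite t0 mul0r.
apply/seteqP; split=> E; first by move=> [A [_ ->]]; rewrite mix.
by move=> ->; exists (fun=> 1%:M); split=> [j|]; rewrite ?unitmx1 ?mix.
Qed.

Lemma tensor_power1_neq0 : psi != 0 -> tensor_power 1 psi != 0.
Proof.
apply: contraNneq => p0; apply/eqP/ffunP => x; rewrite ffunE.
have := congr1 (fun v : 'rV_ _ => v 0 (enum_rank [ffun=> x])) p0.
by rewrite !mxE big_ord1 enum_rankK ffunE.
Qed.

Lemma log_upper_zero :
  psi != 0 -> (forall b, theta b = 0) -> log_upper theta psi = 0%E.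
Proof.
move=> psi0 t0; rewrite /log_upper (negbTE psi0) -[RHS]ereal_sup1.
congr ereal_sup.
have supp b : (theta b != 0) = false by rewrite t0 eqxx.
apply/seteqP; split=> E.
  by move=> [n [lam [_ _ _ ->]]]; rewrite big_pred0.
move=> ->; exists 1%N, (fun=> [:: 1%N]); split=> //; last by rewrite big_pred0.
by rewrite big_pred0 // mulmx1 tensor_power1_neq0.
Qed.

End Scale.

(** * The upper functional of the embedded tensor *)

Definition upper_value (R : realType) k (d : 'I_k -> nat)
    (theta : bipartition k -> R) (psi : tensor R d) n
    (lam : bipartition k -> seq nat) (E : \bar R) : Prop :=
  [/\ (1 <= n)%N,
      forall b, theta b != 0 -> is_partition n (lam b),
      tensor_power n psi *m
        \big[mulmx/1%:M]_(b | theta b != 0) bip_proj R d n b (lam b) != 0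
    & E = (\sum_(b | theta b != 0)
             theta b * shannon [seq m%:R / n%:R | m <- lam b])%:E].

Section Upper.
Variables (R : realType) (l k : nat) (c : 'I_l -> nat).
Variables (s : 'I_l -> 'I_k) (s_inj : injective s).
Variable theta : bipartition k -> R.
Hypothesis theta_ge0 : forall b, 0 <= theta b.
Hypothesis theta_lam :
  forall b b', theta b != 0 -> theta b' != 0 -> mutually_laminar b b'.
Local Notation marg := (marginal s theta).
Local Notation H n lam := (shannon [seq (q%:R / n%:R : R) | q <- lam]).

Lemma marginal_ge0 b0 : 0 <= marg b0.
Proof. exact: sumr_ge0. Qed.

Lemma marginal_neq0P b0 :
  reflect (exists2 b, restrict_bip s b = Some b0 & theta b != 0) (marg b0 != 0).
Proof.
apply: (iffP idP) => [|[b rb tb]].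
  rewrite /marginal psumr_neq0 // => /hasP[b _ /andP[/eqP rb tb]].
  by exists b; rewrite // gt_eqF.
rewrite /marginal psumr_neq0 //; apply/hasP; exists b; first exact: mem_index_enum.
by rewrite rb eqxx /= lt_neqAle eq_sym tb theta_ge0.
Qed.

Lemma marginal_laminar b0 b0' :
  marg b0 != 0 -> marg b0' != 0 -> mutually_laminar b0 b0'.
Proof.
move=> /marginal_neq0P[b rb tb] /marginal_neq0P[b' rb' tb'].
exact: restrict_bip_laminar rb rb' (theta_lam tb tb').
Qed.

Variable psi : tensor R c.

(** Above b0 a partition of largest entropy is kept. If b restricts to no
    bipartition, then a factor with lam b other than (n) would make the product
    vanish. *)
Lemma upper_value_restrict n lam E :
  upper_value theta (embed_tensor s_inj psi) n lam E ->
  exists mu E', upper_value marg psi n mu E' /\ (E <= E')%E.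
Proof.
move=> [n1 plam nz ->].
rewrite embed_power_prod_eq0 in nz.
pose D b := side_proj R c n (s @^-1: side b) (lam b).
have Dcomm b b' : theta b != 0 -> theta b' != 0 -> D b *m D b' = D b' *m D b.
  by move=> tb tb'; apply/restrict_bip_side_proj_comm/theta_lam.
have best b0 : exists mu, marg b0 != 0 -> exists b1,
    [/\ restrict_bip s b1 = Some b0, theta b1 != 0, mu = lam b1
      & forall b, restrict_bip s b = Some b0 -> theta b != 0 ->
          H n (lam b) <= H n mu].
  have [/marginal_neq0P[b rb tb]|_] := boolP (marg b0 != 0); last first.
    by exists [::].
  pose P b := (restrict_bip s b == Some b0) && (theta b != 0).
  have Pb : P b by rewrite /P rb eqxx.
  have [b1 /andP[/eqP rb1 tb1] maxb1] :=
    arg_maxP (P := P) (fun b => H n (lam b)) Pb.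
  exists (lam b1) => _; exists b1; split=> // b' rb' tb'; apply: maxb1.
  by rewrite /P rb' eqxx.
have [mu muP] := boolp.choice best.
exists mu, (\sum_(b0 | marg b0 != 0) marg b0 * H n (mu b0))%:E; split.
  split=> // [b0 /muP[b1 [_ tb1 -> _]]|]; first exact: plam.
  apply: (commuting_product_transfer (Z := symmetric_proj R c n)
    Dcomm _ _ _ _ _ nz).
  - by move=> b _; apply: side_proj_idem.
  - move=> b b0 tb /muP[b1 [rb1 tb1 -> _]].
    by rewrite (restrict_bip_proj R c n _ rb1); apply: Dcomm.
  - by move=> b _; rewrite symmetric_side_proj side_proj_symmetric.
  - exact: tensor_power_symmetric.
  - move=> u _ uD b0 /muP[b1 [rb1 tb1 -> _]].
    by rewrite (restrict_bip_proj R c n _ rb1); apply: uD.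
rewrite lee_fin !big_neq0_cond -marginal_sum; apply: ler_sum => b _.
have [->|tb] := eqVneq (theta b) 0; first by rewrite !mul0r.
rewrite ler_wpM2l //; case rb: (restrict_bip s b) => [b0|].
  have mb0 : marg b0 != 0 by apply/marginal_neq0P; exists b.
  by have [b1 [_ _ _ h]] := muP _ mb0; apply: h.
have [->|lamb] := eqVneq (lam b) [:: n]; first by rewrite shannon_one_row.
case/eqP: nz; rewrite -(mulmx_prod_absorb (i := b)) //; last 2 first.
- by move=> b' tb'; apply: Dcomm.
- exact: side_proj_idem.
rewrite (side_proj_trivial R c n1 (plam _ tb) rb) (negbTE lamb).
by rewrite scale0r !mulmx0.
Qed.

(** Copying the partition of b0 to every b above it repeats a projector, which is
    harmless because the projectors are commuting idempotents; where nothing is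
    separated, (n) gives the projector onto symmetric tensors, which fixes
    tensor powers. *)
Lemma upper_value_extend n mu E :
  upper_value marg psi n mu E ->
  exists lam, upper_value theta (embed_tensor s_inj psi) n lam E.
Proof.
move=> [n1 pmu nz ->].
pose lam b := if restrict_bip s b is Some b0 then mu b0 else [:: n].
have margN b b0 : restrict_bip s b = Some b0 -> theta b != 0 -> marg b0 != 0.
  by move=> rb tb; apply/marginal_neq0P; exists b.
have plam b : theta b != 0 -> is_partition n (lam b).
  rewrite /lam; case rb: (restrict_bip s b) => [b0|] tb; first exact/pmu/(margN b).
  by rewrite /is_partition /= addn0 eqxx inE eq_sym -lt0n n1.
exists lam; split=> //.
  rewrite embed_power_prod_eq0.
  apply: (commuting_product_transfer (Z := symmetric_proj R c n)
    _ _ _ _ _ _ nz).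
  - move=> b0 b0' /marginal_neq0P[b rb tb] /marginal_neq0P[b' rb' tb'].
    rewrite (restrict_bip_proj R c n _ rb) (restrict_bip_proj R c n _ rb').
    exact/restrict_bip_side_proj_comm/theta_lam.
  - move=> b0 /marginal_neq0P[b rb _].
    by rewrite (restrict_bip_proj R c n _ rb) side_proj_idem.
  - move=> b0 b /marginal_neq0P[b1 rb1 tb1] tb.
    rewrite (restrict_bip_proj R c n _ rb1).
    exact/restrict_bip_side_proj_comm/theta_lam.
  - move=> b0 /marginal_neq0P[b rb _].
    rewrite (restrict_bip_proj R c n _ rb).
    by rewrite symmetric_side_proj side_proj_symmetric.
  - exact: tensor_power_symmetric.
  - move=> u uZ uD b tb; have pb := plam b tb; move: pb; rewrite /lam.
    case rb: (restrict_bip s b) => [b0|] pb.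
      by rewrite -(restrict_bip_proj R c n _ rb); apply/uD/(margN b).
    by rewrite (side_proj_trivial R c n1 pb rb) eqxx scale1r.
congr EFin; rewrite !big_neq0_cond -marginal_sum; apply: eq_bigr => b _.
rewrite /lam; case: (restrict_bip s b) => [//|].
by rewrite shannon_one_row.
Qed.

Lemma log_upper_embed :
  log_upper theta (embed_tensor s_inj psi) = log_upper marg psi.
Proof.
rewrite /log_upper embed_tensor_eq0; case: eqP => // _.
apply/eqP; rewrite eq_le; apply/andP; split; apply: ge_ereal_sup => E [n [lam v]].
  have [mu [E' [v' EE']]] := upper_value_restrict v.
  by apply: le_trans EE' _; apply: ereal_sup_ubound; exists n, mu.
have [lam' v'] := upper_value_extend v.
by apply: ereal_sup_ubound; exists n, lam'.
Qed.

End Upper.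

(** * Embeddings preserve the equality of the functionals *)

Lemma log_functionals_eq_embed (R : realType) (l k : nat) (c : 'I_l -> nat)
    (psi : tensor R c) (s : 'I_l -> 'I_k) (s_inj : injective s) :
  (forall theta : bipartition l -> R, laminar_distribution theta ->
     log_upper theta psi = log_lower theta psi) ->
  forall theta : bipartition k -> R, laminar_distribution theta ->
    log_upper theta (embed_tensor s_inj psi) =
    log_lower theta (embed_tensor s_inj psi).
Proof.
move=> agreed theta [t0 t1 tlam].
rewrite log_upper_embed // log_lower_embed.
have [->|psi0] := eqVneq psi 0; first by rewrite /log_upper /log_lower eqxx.
pose m := \sum_b0 marginal s theta b0.
have m0 : 0 <= m by apply: sumr_ge0 => b0 _; apply: marginal_ge0.
have [mz|mn] := eqVneq m 0.
  have marg0 b0 : marginal s theta b0 = 0.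
    move/eqP: mz; rewrite /m psumr_eq0 => [|b1 _]; last exact: marginal_ge0.
    by move=> /allP/(_ b0 (mem_index_enum _))/eqP.
  by rewrite log_upper_zero // log_lower_zero.
have mp : 0 < m by rewrite lt_neqAle eq_sym mn m0.
pose theta1 b0 := m^-1 * marginal s theta b0.
have -> : marginal s theta = (fun b0 => m * theta1 b0).
  by apply/funext => b0; rewrite /theta1 mulVKf.
rewrite log_upper_scale // log_lower_scale // agreed //; split.
- by move=> b0; rewrite mulr_ge0 ?invr_ge0 ?marginal_ge0.
- by rewrite -mulr_sumr mulVf.
- move=> b0 b0'; rewrite !mulf_eq0 !negb_or => /andP[_ n0] /andP[_ n0'].
  exact: (marginal_laminar t0 tlam n0 n0').
Qed.

Lemma exp2e_inj (R : realType) : injective (@exp2e R).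
Proof.
move=> x y /expeR_inj/eqP; rewrite eq_le => e.
have ln2 : (0 < (ln 2 : R)%:E)%E by rewrite lte_fin ln_gt0 // ltr1n.
by apply/eqP; rewrite eq_le; move: e; rewrite !lee_pmul2l.
Qed.

Theorem proposition4p12 (R : realType) (l k : nat) (l_ge1 : (1 <= l)%N)
    (lt_lk : (l < k)%N) (c : 'I_l -> nat) (psi : tensor R c) :
  ((forall theta : bipartition l -> R, laminar_distribution theta ->
      log_upper theta psi = log_lower theta psi) ->
   forall theta : bipartition k -> R, laminar_distribution theta ->
     log_upper theta (standard_embed lt_lk psi) =
     log_lower theta (standard_embed lt_lk psi))
  /\
  (laminar_quantum_robust psi ->
   forall (s : 'I_l -> 'I_k) (s_inj : injective s),
     laminar_quantum_robust (embed_tensor s_inj psi)).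
Proof.
split=> [agreed theta|[psi0 agreed] s s_inj]; first exact: log_functionals_eq_embed.
split=> [|theta lam_theta]; first by rewrite embed_tensor_eq0.
congr exp2e; apply: log_functionals_eq_embed lam_theta => theta' lam'.
by apply: exp2e_inj; apply: agreed.
Qed.
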